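(* Let $G$ be a graph and let $Q$, $R$, $S$, $T$ be subsets of $V(G)$ such that $Q\cap R=S\cap T=\emptyset$. Let $\kappa_{G}(Q,R)=k$, $\kappa_{G}(S,T)=\ell$, and $F=V(G)-(Q\cup R\cup S\cup T)$. If $|F|\geq (2\ell+1)2^{2k}$, then there exists a vertex $v$ in $F$ such that at least one of the following holds: (i) $\kappa_{G\setminus v}(Q,R)=k$ and $\kappa_{G\setminus v}(S,T)=\ell$. (ii) $\kappa_{G\wedge uv\setminus v}(Q,R)=k$ and $\kappa_{G\wedge uv\setminus v}(S,T)=\ell$ for each neighbor $u$ of $v$ in $G$.
   Context: All graphs are finite and simple (no loops or parallel edges). $G\setminus v$ denotes the graph obtained from $G$ by deleting the vertex $v$. For a vertex $v$ of $G$, $G*v$ denotes the local complementation of $G$ at $v$: the graph on the same vertex set obtained from $G$ by, for each pair $x,y$ of distinct neighbors of $v$, adding the edge $xy$ if $x,y$ are non-adjacent in $G$ and removing it otherwise. For an edge $uv$ of $G$, pivoting $uv$ gives $G\wedge uv=G*u*v*u$ (operations applied left to right; this equals $G*v*u*v$). For $X\subseteq V(G)$, the cut-rank $\rho_G(X)$ is the rank over $\mathrm{GF}(2)$ of the $X\times (V(G)-X)$ matrix whose $(i,j)$-entry is $1$ if $i$ and $j$ are adjacent in $G$ and $0$ otherwise. For disjoint $S,T\subseteq V(G)$, the connectivity between $S$ and $T$ is $\kappa_G(S,T)=\min_{S\subseteq X\subseteq V(G)-T}\rho_G(X)$. *)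

(* Defs.v *)
From HB Require Import structures.
From mathcomp Require Import all_boot all_order all_algebra.
Set Implicit Arguments.
Unset Strict Implicit.
Unset Printing Implicit Defensive.

(* The vertex set is a subset of an ambient finite type [U], so that vertex
   deletion stays within one type and subsets of V(G) need no transport. *)
Record graph (U : finType) := Graph {
  vertices : {set U};
  adj : rel U;
  adj_sym : symmetric adj;
  adj_irrefl : irreflexive adj;
  adj_vertex : forall x y, adj x y -> x \in vertices
}.

Section GraphOperations.
Variable U : finType.
Implicit Types (G : graph U) (u v : U) (X S T : {set U}).

Definition delete_adj G v : rel U := fun x y => [&& x != v, y != v & adj G x y].

Lemma delete_adj_sym G v : symmetric (delete_adj G v).
Proof. by move=> x y; rewrite /delete_adj adj_sym andbCA. Qed.

Lemma delete_adj_irrefl G v : irreflexive (delete_adj G v).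
Proof. by move=> x; rewrite /delete_adj adj_irrefl !andbF. Qed.

Lemma delete_adj_vertex G v x y : delete_adj G v x y -> x \in vertices G :\ v.
Proof. by case/and3P=> xv _ /adj_vertex xG; rewrite !inE xv. Qed.

Definition delete G v : graph U :=
  Graph (@delete_adj_sym G v) (@delete_adj_irrefl G v) (@delete_adj_vertex G v).

Definition local_compl_adj G v : rel U :=
  fun x y => adj G x y (+) [&& x != y, adj G v x & adj G v y].

Lemma local_compl_adj_sym G v : symmetric (local_compl_adj G v).
Proof.
by move=> x y; rewrite /local_compl_adj adj_sym eq_sym [adj G v x && _]andbC.
Qed.

Lemma local_compl_adj_irrefl G v : irreflexive (local_compl_adj G v).
Proof. by move=> x; rewrite /local_compl_adj adj_irrefl eqxx. Qed.

Lemma local_compl_adj_vertex G v x y :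
  local_compl_adj G v x y -> x \in vertices G.
Proof.
rewrite /local_compl_adj; case: (boolP (adj G x y)) => [/adj_vertex //|_].
by case/and3P=> _ + _; rewrite adj_sym => /adj_vertex.
Qed.

Definition local_compl G v : graph U :=
  Graph (@local_compl_adj_sym G v) (@local_compl_adj_irrefl G v)
        (@local_compl_adj_vertex G v).

(* Only meaningful when [u] and [v] are adjacent in [G]. *)
Definition pivot G u v : graph U :=
  local_compl (local_compl (local_compl G u) v) u.

Definition cut_matrix G X : 'M['F_2]_(#|X|, #|vertices G :\: X|) :=
  \matrix_(i, j) ((adj G (enum_val i) (enum_val j))%:R)%R.

Definition cut_rank G X : nat := \rank (cut_matrix G X).

(* Only meaningful when [S] and [T] are disjoint subsets of [vertices G]; then
   [S] is itself a candidate, so the arg min ranges over a nonempty family. *)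
Definition connectivity G S T : nat :=
  cut_rank G
    [arg min_(X < S | (S \subset X) && (X \subset vertices G :\: T))
       cut_rank G X].

End GraphOperations.

(* Main.v *)
Require Import Defs.
From HB Require Import structures.
From mathcomp Require Import all_boot all_order all_algebra.
From mathcomp Require Import finfield zify.
Set Implicit Arguments.
Unset Strict Implicit.
Unset Printing Implicit Defensive.
Import GRing.Theory.

(* Over GF(2), the graph [G] is encoded by the Lagrangian space
   L = {(x, A x)} of (GF(2)^2)^V, A being the adjacency matrix, and the cut-rank
   of X is |X| - dim L_X, where L_X is the space of members of L supported on X.
   Deleting v, deleting it after a pivot and deleting it after a local
   complementation amount to restricting L at v to (0,1), (1,0) and (1,1),
   respectively. A vector g is bad at v for (Q,R) when some X with cut-rank k is
   such that a member of L supported on X + v has value g at v; restricting to g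
   lowers the connectivity only if g is bad, and submodularity shows that at most
   one g is bad at v.

   If the theorem fails, every v in F has a bad e_v for (Q,R) and a bad e'_v for
   (S,T), with {e_v, e'_v} = {(1,0), (0,1)}. Restrict L at all vertices outside
   Q and R, with the value (1,1) on F; this preserves the connectivity k, and the
   vectors of L obeying the restriction, modulo those whose restriction to a
   minimum cut is in L, form a space of dimension 2k, the same for every minimum
   cut. Each v in F gives one of its 4^k - 1 nonzero classes, so 2l + 2 vertices
   share a class x0. For those, x0 restricted to a minimum cut of v, plus e_v at v,
   is in L; the pairwise sums of these vectors span a space W of dimension at
   least 2l + 1, whose members vanish on Q and R and are never e'_v at v in F.
   Since a minimum (S,T)-cut Y has cut-rank l, some nonzero x in W has its
   restriction to Y in L. Going down a chain of minimum (S,T)-cuts, x can be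
   nonzero at v in F only with the value e'_v; hence x vanishes on F and x = 0. *)

(* [lia] alone is very slow on dimensions and cardinals of compound terms. *)
Ltac dim_lia :=
  unfold reverse_coercion;
  repeat match goal with
  | |- context [@dimv ?f ?vT ?A] => generalize (@dimv f vT A)
  | |- context [@card.body ?T ?A] => generalize (@card.body T A)
  end; clear; lia.

(** * Arithmetic and dimension counts over GF(2) *)

Section BinaryField.
Local Open Scope ring_scope.
Variable F : finFieldType.
Hypothesis cardF : #|F| = 2%N.
Notation K := (F^o * F^o)%type.

Lemma F2_cases (a : F) : a = 0 \/ a = 1.
Proof.
have /subset_leqif_cards[_] : [set 0; 1] \subset [set: F] by apply/subsetP => x.
rewrite cards2 cardsT cardF [0 == _]eq_sym oner_eq0 /= eqxx => /esym/eqP/setP/(_ a).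
by rewrite !inE => /orP[]/eqP; [left | right].
Qed.

Lemma F2_11 : 1 + 1 = 0 :> F.
Proof.
have [//|/eqP] := F2_cases (1 + 1).
by rewrite -subr_eq0 addrK oner_eq0.
Qed.

Lemma F2_addvv (V : lmodType F) (x : V) : x + x = 0.
Proof. by rewrite -[x]scale1r -scalerDl F2_11 scale0r. Qed.

Lemma F2_scale (V : lmodType F) (a : F) (x : V) : a *: x = 0 \/ a *: x = x.
Proof.
by have [->|->] := F2_cases a; [left; rewrite scale0r | right; rewrite scale1r].
Qed.

Lemma K_cases (p : K) : [\/ p = 0, p = (1, 0), p = (0, 1) | p = (1, 1)].
Proof.
case: p => p q; have [->|->] := F2_cases p; have [->|->] := F2_cases q.
- exact: Or41. - exact: Or43. - exact: Or42. - exact: Or44.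
Qed.

(** The symplectic form on GF(2)^2, the sign being immaterial in characteristic 2. Two distinct
    nonzero vectors always pair to 1. *)
Definition omega (p q : K) : F := p.1 * q.2 + p.2 * q.1.

Lemma omegaC p q : omega p q = omega q p.
Proof. by rewrite /omega addrC mulrC [p.1 * _]mulrC. Qed.

Lemma omegapp p : omega p p = 0.
Proof. by rewrite /omega mulrC; apply: (@F2_addvv F^o). Qed.

Lemma omega_parallel (p q : K) : q != 0 -> omega p q = 0 -> p = 0 \/ p = q.
Proof.
have tab := (mul0r, mulr0, mulr1, addr0, add0r).
have := oner_eq0 F; rewrite /omega.
have [->|->|->|->] := K_cases p; have [->|->|->|->] := K_cases q;
  rewrite /= ?tab ?eqxx; by [left | right | move=> /eqP ne _ /ne].
Qed.

Lemma omegaD p q r : omega (p + q) r = omega p r + omega q r.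
Proof. by rewrite /omega /= !mulrDl addrACA. Qed.

Lemma omegaZ (a : F) p r : omega (a *: p) r = a * omega p r.
Proof. by rewrite /omega /= mulrDr !mulrA. Qed.

Lemma omega0l p : omega 0 p = 0. Proof. by rewrite /omega !mul0r addr0. Qed.
Lemma omega0r p : omega p 0 = 0. Proof. by rewrite omegaC omega0l. Qed.

Lemma dimv_add1 (vT : vectType F) (V : {vspace vT}) (x : vT) :
  x \notin V -> \dim (V + <[x]>) = (\dim V).+1.
Proof.
move=> xV; rewrite dimv_disjoint_sum.
  by rewrite dim_vline (contraNneq _ xV) ?addn1 // => ->; rewrite mem0v.
apply/eqP; rewrite -subv0; apply/subvP => y /memv_capP[yV /vlineP[a ya]].
by move: yV; rewrite ya memv0; have [->|->] := F2_scale a x; rewrite ?(negPf xV).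
Qed.

(** [V] is covered by [W] and one coset of it, so [V] lies in [V :&: W] plus the line of [x]. *)
Lemma dimv_hyperplane (vT : vectType F) (V W : {vspace vT}) (x : vT) :
    x \in V -> {in V, forall y, y \in W \/ y - x \in W} ->
  (\dim V <= (\dim (V :&: W)).+1)%N.
Proof.
move=> xV hV; have: (V <= (V :&: W) + <[x]>)%VS.
  apply/subvP => y yV; have [yW|yxW] := hV y yV.
    by rewrite -[y]addr0 memv_add ?mem0v // memv_cap yV.
  by rewrite -[y](subrK x) memv_add ?memv_line // memv_cap yxW memvB.
move/dimvS/leq_trans; apply; rewrite (leq_trans (dimv_add_leqif _ _)) //.
by rewrite dim_vline; case: (x != 0); rewrite ?addn1 ?addn0.
Qed.

(** * Lagrangian spaces and their reductions *)

Section Lagrangian.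
Variable U : finType.
Notation vT := {ffun U -> K}.
Implicit Types (L : {vspace vT}) (X Y : {set U}) (v u : U) (x y z : vT).
Implicit Types (e f g : K).

Definition form x y : F := \sum_v omega (x v) (y v).

Definition restrict X x : vT := [ffun v => if v \in X then x v else 0].

Lemma restrict_linear X : linear (restrict X).
Proof.
move=> a x y; apply/ffunP => v; rewrite !ffunE; case: ifP => // _.
by rewrite scaler0 addr0.
Qed.
HB.instance Definition _ X :=
  GRing.isLinear.Build F vT vT _ (restrict X) (restrict_linear X).

Definition supp X : {vspace vT} := lker (linfun (restrict (~: X))).

Lemma suppP X x : reflect (forall v, v \notin X -> x v = 0) (x \in supp X).
Proof.
rewrite memv_ker lfunE /=; apply: (iffP eqP) => [/ffunP xX v vX | xX].
  by have := xX v; rewrite !ffunE inE vX.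
by apply/ffunP => v; rewrite !ffunE inE; case: ifP => // /xX.
Qed.

Definition single v g : vT := [ffun u => if u == v then g else 0].

Lemma singleE v g u : single v g u = if u == v then g else 0.
Proof. exact: ffunE. Qed.

Lemma form_single x v g : form x (single v g) = omega (x v) g.
Proof.
rewrite /form (bigD1 v) //= singleE eqxx big1 ?addr0 // => u /negPf uv.
by rewrite singleE uv omega0r.
Qed.

Definition pairing v g x : F^o := omega (x v) g.

Lemma pairing_linear v g : linear (pairing v g).
Proof. by move=> a x y; rewrite /pairing !ffunE omegaD omegaZ. Qed.
HB.instance Definition _ v g :=
  GRing.isLinear.Build F vT _ _ (pairing v g) (pairing_linear v g).

Definition perp v g : {vspace vT} := lker (linfun (pairing v g)).

Lemma perpP v g x : (x \in perp v g) = (omega (x v) g == 0).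
Proof. by rewrite memv_ker lfunE. Qed.

Lemma formC x y : form x y = form y x.
Proof. by apply: eq_bigr => v _; rewrite omegaC. Qed.

Lemma formD x y z : form (x + y) z = form x z + form y z.
Proof. by rewrite -big_split; apply: eq_bigr => v _; rewrite ffunE omegaD. Qed.

Lemma formDr x y z : form x (y + z) = form x y + form x z.
Proof. by rewrite formC formD !(formC x). Qed.

Definition isotropic L := {in L &, forall x y, form x y = 0}.

(** In coordinates, bases of [A] and [B] become matrices (A1 | A2) and (B2 | B1) with 2|X| columns.
    The first times the transpose of the second is the Gram matrix of [form], which is zero, so the
    two ranks add up to at most 2|X|. *)
Lemma orthogonal_dim X (A B : {vspace vT}) :
    (A <= supp X)%VS -> (B <= supp X)%VS ->
    {in A & B, forall x y, form x y = 0} ->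
  (\dim A + \dim B <= #|X| + #|X|)%N.
Proof.
move=> sA sB AB.
pose mx1 (W : {vspace vT}) : 'M[F]_(\dim W, #|X|) :=
  \matrix_(i, j) ((vbasis W)`_i (enum_val j)).1.
pose mx2 (W : {vspace vT}) : 'M[F]_(\dim W, #|X|) :=
  \matrix_(i, j) ((vbasis W)`_i (enum_val j)).2.
have memb k (W : {vspace vT}) : (k < \dim W)%N -> (vbasis W)`_k \in W.
  by move=> lt_k; rewrite vbasis_mem // mem_nth ?size_tuple.
have comb (W : {vspace vT}) (c : 'rV[F]_(\dim W)) : (W <= supp X)%VS ->
    c *m mx1 W = 0 -> c *m mx2 W = 0 -> c = 0.
  move=> sW c1 c2; apply/rowP => i; rewrite mxE.
  have /freeP -> // := basis_free (vbasisP W).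
  apply/ffunP => v; rewrite sum_ffunE ffunE.
  have [vX | vX] := boolP (v \in X); last first.
    rewrite big1 // => j _; rewrite ffunE.
    by have /suppP-> := subvP sW _ (memb _ _ (ltn_ord j)); rewrite ?scaler0.
  have sE (h : {linear K -> F^o}) : h (\sum_j (c 0 j *: (vbasis W)`_j) v) =
      \sum_j c 0 j * h ((vbasis W)`_j v).
    by rewrite linear_sum; apply: eq_bigr => j _; rewrite ffunE linearZ.
  pose r := enum_rank_in vX v.
  rewrite [LHS]surjective_pairing; congr (_, _).
    rewrite (sE fst); have := congr1 (fun m : 'rV_ _ => m 0 r) c1.
    rewrite !mxE; apply: etrans; apply: eq_bigr => j _.
    by rewrite mxE enum_rankK_in.
  rewrite (sE snd); have := congr1 (fun m : 'rV_ _ => m 0 r) c2.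
  rewrite !mxE; apply: etrans; apply: eq_bigr => j _.
  by rewrite mxE enum_rankK_in.
have rkA : \rank (row_mx (mx1 A) (mx2 A)) = \dim A.
  apply/eqP/inj_row_free => c; rewrite mul_mx_row -[0]row_mx0.
  by case/eq_row_mx; apply: comb.
have rkB : \rank (row_mx (mx2 B) (mx1 B)) = \dim B.
  apply/eqP/inj_row_free => c; rewrite mul_mx_row -[0]row_mx0.
  by case/eq_row_mx => ? ?; apply: comb.
rewrite -rkA -rkB -[X in (_ + X <= _)%N]mxrank_tr.
apply: mulmx0_rank_max; rewrite tr_row_mx mul_row_col.
apply/matrixP => i j; rewrite !mxE -big_split /=.
have AB0 := AB _ _ (memb _ _ (ltn_ord i)) (memb _ _ (ltn_ord j)).
rewrite -[RHS]AB0 /form [RHS](bigID (mem X)) /= [X in _ + X]big1 ?addr0.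
  by rewrite [RHS]big_enum_val; apply: eq_bigr => t _; rewrite !mxE.
move=> v vX; have /suppP-> // := subvP sA _ (memb _ _ (ltn_ord i)).
exact: omega0l.
Qed.

(** The space L_X; for the space of a graph, |X| - dim L_X is the cut-rank of X. *)
Definition loc L X : {vspace vT} := (L :&: supp X)%VS.

Lemma locP L X x : reflect (x \in L /\ forall v, v \notin X -> x v = 0) (x \in loc L X).
Proof. by apply: (iffP memv_capP) => -[xL /suppP]. Qed.

Lemma locS L X Y : X \subset Y -> (loc L X <= loc L Y)%VS.
Proof.
move=> sXY; apply/subvP => x /locP[xL x0]; apply/locP; split=> // v vY.
by apply: x0; apply: contraNN vY; apply/subsetP.
Qed.

Lemma locSl L M X : (L <= M)%VS -> (loc L X <= loc M X)%VS.
Proof. by move=> sLM; rewrite capvS. Qed.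

Lemma locI L X Y : loc L (X :&: Y) = (loc L X :&: loc L Y)%VS.
Proof.
apply/vspaceP => x; apply/idP/idP => [|/memv_capP[/locP[xL xX] /locP[_ xY]]].
  by move=> xI; rewrite memv_cap !(subvP (locS _ _) _ xI) ?subsetIl ?subsetIr.
by apply/locP; split=> // v; rewrite inE negb_and => /orP[/xX|/xY].
Qed.

Definition lagrangian L := isotropic L /\ \dim L = #|U|.

Lemma isotropic_dim L : isotropic L -> (\dim L <= #|U|)%N.
Proof.
move=> isoL; have sL : (L <= supp setT)%VS.
  by apply/subvP => x _; apply/suppP => v; rewrite inE.
by have := orthogonal_dim sL sL isoL; rewrite cardsT; dim_lia.
Qed.

Lemma form_restrict X x y : y \in supp X -> form (restrict X x) y = form x y.
Proof.
move/suppP=> y0; apply: eq_bigr => v _; rewrite ffunE.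
by case: ifPn => // /y0->; rewrite !omega0r.
Qed.

(** This is the symmetry of cut-rank. The restriction of [L] to Y is orthogonal to L_Y and has
    kernel L_(~Y), which gives one inequality; taking Y to be [X] and then its complement gives
    both. *)
Lemma loc_setC L X : lagrangian L ->
  (\dim (loc L (~: X)) + #|X| = \dim (loc L X) + #|~: X|)%N.
Proof.
case=> isoL dimL.
have half Y : (\dim (loc L Y) + #|U| <= \dim (loc L (~: Y)) + #|Y| + #|Y|)%N.
  have := limg_ker_dim (linfun (restrict Y)) L.
  have -> : (L :&: lker (linfun (restrict Y)) = loc L (~: Y))%VS.
    by rewrite /loc /supp setCK.
  rewrite dimL => <-.
  rewrite addnC -!addnA leq_add2l; apply: orthogonal_dim => [||x y].
  - apply/subvP => _ /memv_imgP[x _ ->]; apply/suppP => v /negPf vY.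
    by rewrite lfunE /= ffunE vY.
  - exact: capvSr.
  move=> /memv_imgP[z zL ->] /memv_capP[yL ys].
  by rewrite lfunE /= form_restrict // isoL.
have := half X; have := half (~: X); rewrite setCK.
have := cardsC X; dim_lia.
Qed.

Lemma perp_dim (W : {vspace vT}) v g : (\dim W <= (\dim (W :&: perp v g)).+1)%N.
Proof.
have [sW | /subvPn[x xW xp]] := boolP (W <= perp v g)%VS.
  by move/capv_idPl: sW => ->.
apply: dimv_hyperplane (xW) _ => y yW; rewrite !perpP in xp *.
have ox : omega (x v) g = 1.
  by have [ox|//] := F2_cases (omega (x v) g); rewrite ox eqxx in xp.
have [->|oy] := F2_cases (omega (y v) g); first by left.
right; rewrite -scaleN1r !ffunE omegaD omegaZ ox oy mulN1r subrr //.
Qed.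

(* The span of [single v g] keeps the reduction Lagrangian over the same vertex set. *)
Definition red L v g : {vspace vT} := ((L :&: perp v g) + <[single v g]>)%VS.

Lemma redP L v g x : reflect
  (exists2 y, y \in L & omega (y v) g = 0 /\ (x = y \/ x = y + single v g))
  (x \in red L v g).
Proof.
apply: (iffP memv_addP) => [[y yL [z /vlineP[a ->] ->]] | [y yL [yg xE]]].
  move: yL; rewrite memv_cap perpP => /andP[yL /eqP yg]; exists y => //; split=> //.
  by have [->|->] := F2_scale a (single v g); rewrite ?addr0; [left | right].
exists y; first by rewrite memv_cap perpP yL yg /=.
case: xE => ->; last by exists (single v g); rewrite ?memv_line.
by exists 0; rewrite ?mem0v ?addr0.
Qed.

Lemma single_red L v g : single v g \in red L v g.
Proof. by apply: subvP (addvSr _ _) _ _; apply: memv_line. Qed.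

Lemma cap_perp_red L v g : (L :&: perp v g <= red L v g)%VS.
Proof. exact: addvSl. Qed.

Lemma isotropic_perp L v g : isotropic L -> single v g \in L -> (L <= perp v g)%VS.
Proof.
by move=> isoL gL; apply/subvP => x xL; rewrite perpP -form_single isoL.
Qed.

Lemma red_isotropic L v g : isotropic L -> isotropic (red L v g).
Proof.
move=> isoL x' y' /redP[x xL [xg xE]] /redP[y yL [yg yE]].
have xs : form x (single v g) = 0 by rewrite form_single.
have ys : form (single v g) y = 0 by rewrite formC form_single.
have ss : form (single v g) (single v g) = 0 by rewrite form_single singleE eqxx omegapp.
have xy : form x y = 0 by apply: isoL.
by case: xE => ->; case: yE => ->; rewrite ?formD ?formDr ?xs ?ys ?ss ?xy ?addr0.
Qed.

(** If [single v g] is in [L], then isotropy puts all of [L] in [perp v g] and nothing is lost.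
    Otherwise the orthogonality condition costs at most one dimension, which the new vector
    [single v g] restores. *)
Lemma red_dim_loc L X v g : isotropic L -> v \in X ->
  (\dim (loc L X) <= \dim (loc (red L v g) X))%N.
Proof.
move=> isoL vX; have sg : single v g \in loc (red L v g) X.
  apply/locP; split=> [|u uX]; first exact: single_red.
  by rewrite singleE; case: eqP => // uv; rewrite uv vX in uX.
have sub : (loc L X :&: perp v g <= loc (red L v g) X)%VS.
  by rewrite /loc -capvA [(supp _ :&: _)%VS]capvC capvA locSl // cap_perp_red.
have [gL | gL] := boolP (single v g \in L).
  apply: dimvS; apply: subv_trans sub; rewrite subv_cap subvv /=.
  exact: subv_trans (capvSl _ _) (isotropic_perp isoL gL).
apply: leq_trans (perp_dim _ v g) _.
rewrite -(@dimv_add1 _ _ (single v g)); last first.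
  by apply: contra gL => /memv_capP[/locP[]].
by apply: dimvS; rewrite subv_add sub.
Qed.

Lemma loc_setT L : loc L setT = L.
Proof.
apply/vspaceP => x; apply/idP/idP => [/locP[]//|xL].
by apply/locP; split=> // v; rewrite inE.
Qed.

Lemma red_lagrangian L v g : lagrangian L -> lagrangian (red L v g).
Proof.
case=> isoL dimL; have isoR := red_isotropic (v := v) (g := g) isoL.
split=> //; apply/eqP; rewrite eqn_leq isotropic_dim // -dimL.
by have := red_dim_loc g isoL (in_setT v); rewrite !loc_setT.
Qed.

Lemma red_loc_mono L X v g : isotropic L ->
  (\dim (loc L X) <= \dim (loc (red L v g) X))%N.
Proof.
move=> isoL; have [vX | vX] := boolP (v \in X); first exact: red_dim_loc.
apply: dimvS; apply/subvP => x /locP[xL x0]; apply/locP; split=> //.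
by apply/redP; exists x => //; rewrite x0 // omega0l; split; [|left].
Qed.

(** * Separations and bad values *)

Section Separations.
Variables (Q D : {set U}) (k : nat).

(* For the pair (Q,R) of a graph [G], [D] is [vertices G :\: R]. *)
Definition sep X := (Q \subset X) && (X \subset D).

Lemma sepI X Y : sep X -> sep Y -> sep (X :&: Y).
Proof.
move=> /andP[QX XD] /andP[QY _]; apply/andP.
by rewrite subsetI QX QY (subset_trans _ XD) // subsetIl.
Qed.

Lemma sepU X Y : sep X -> sep Y -> sep (X :|: Y).
Proof.
move=> /andP[QX XD] /andP[_ YD]; apply/andP.
by rewrite subUset XD YD (subset_trans QX) // subsetUl.
Qed.

Lemma sepU1 X v : sep X -> v \in D -> sep (v |: X).
Proof.
move=> /andP[QX XD] vD; apply/andP.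
by rewrite subUset sub1set vD XD (subset_trans QX) // subsetUr.
Qed.

Lemma sepD1 X v : sep X -> v \notin Q -> sep (X :\ v).
Proof.
move=> /andP[QX XD] vQ; apply/andP; rewrite subsetD1 QX vQ.
by rewrite (subset_trans _ XD) ?subsetDl.
Qed.

(** The lower bound k on the cut-rank |X| - dim L_X, arranged to avoid truncated subtraction. *)
Definition conn_ge L := forall X, sep X -> (\dim (loc L X) + k <= #|X|)%N.

(* Meant under [conn_ge L], where it says that [X] is a cut of minimum rank [k]. *)
Definition min_sep L X := sep X /\ (#|X| <= \dim (loc L X) + k)%N.

Definition bad L v g := exists X w,
  [/\ min_sep L X, v \notin X, w \in loc L (v |: X) & w v = g].

(** Members of L_X + L_Y vanish at [v], so witnesses with distinct nonzero values there add two
    dimensions to it, while X :|: Y gains only the vertex [v]. By submodularity this contradicts the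
    bound [k] at X :&: Y and v |: (X :|: Y). *)
Lemma bad_unique L v g h : v \in D -> conn_ge L -> g != 0 -> h != 0 ->
  bad L v g -> bad L v h -> g = h.
Proof.
move=> vD ge g0 h0 [X [x [[sX mX] vX xX xv]]] [Y [y [[sY mY] vY yY yv]]].
apply/eqP/negPn/negP => gh.
pose S := (loc L X + loc L Y)%VS.
have S0 z : z \in S -> z v = 0.
  by case/memv_addP => a /locP[_ a0] [b /locP[_ b0] ->]; rewrite ffunE a0 ?b0 ?addr0.
have xS : x \notin S by apply: contra_neqN g0 => /S0; rewrite xv.
have yS : y \notin (S + <[x]>)%VS.
  apply/memv_addP => -[a /S0 av [z /vlineP[b ->] ye]].
  move: yv; rewrite ye ffunE av add0r => yv.
  have [bx|bx] := F2_scale b x; rewrite bx in yv.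
    by rewrite -yv ffunE eqxx in h0.
  by rewrite -xv yv eqxx in gh.
have sub : (S + <[x]> + <[y]> <= loc L (v |: (X :|: Y)))%VS.
  have sX' : v |: X \subset v |: (X :|: Y) by rewrite setUS ?subsetUl.
  have sY' : v |: Y \subset v |: (X :|: Y) by rewrite setUS ?subsetUr.
  rewrite !subv_add -!memvE (subvP (locS L sX') _ xX) (subvP (locS L sY') _ yY).
  rewrite !andbT; apply/andP; split; apply: locS.
    exact: subset_trans (subsetUr _ _) sX'.
  exact: subset_trans (subsetUr _ _) sY'.
have := dimvS sub; rewrite dimv_add1 // dimv_add1 //.
have := dimv_sum_cap (loc L X) (loc L Y); rewrite -locI -/S.
have := ge _ (sepU1 (sepU sX sY) vD); have := ge _ (sepI sX sY).
have := cardsUI X Y; rewrite cardsU1 inE negb_or vX vY /=; move: mX mY; dim_lia.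
Qed.

(** A cut X violating the bound after the reduction is compared with Y = X - v and Z = X + v. The
    part [P] of L_Z orthogonal to [g] at [v] is at most one dimension smaller than the reduced space
    on Z. The second conclusion serves later to exclude the zero class. *)
Lemma red_not_conn_ge L v g : v \in D -> v \notin Q -> isotropic L -> g != 0 ->
  conn_ge L -> ~ conn_ge (red L v g) -> bad L v g /\ single v g \notin L.
Proof.
move=> vD vQ isoL g0 ge; set L' := red L v g => nge.
have gL : single v g \notin L.
  apply/negP => gL; apply: nge => X /ge; apply: leq_trans; rewrite leq_add2r.
  apply/dimvS/locSl; rewrite subv_add -memvE gL andbT; exact: capvSl.
split=> //; have [X sX dX] : exists2 X, sep X & (#|X| < \dim (loc L' X) + k)%N.
  have [X /andP[sX dX]|no] := pickP (fun X => sep X && (#|X| < \dim (loc L' X) + k)%N).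
    by exists X.
  by case: nge => X sX; rewrite leqNgt; have := no X; rewrite sX /= => ->.
have isoL' : isotropic L' by apply: red_isotropic.
pose Y := X :\ v; pose Z := v |: X.
have cZ : #|Z| = #|Y|.+1.
  by have := cardsD1 v X; rewrite cardsU1 -/Y; case: (v \in X) => /=; dim_lia.
have dZ : (#|Z| < \dim (loc L' Z) + k)%N.
  have [vX|vX] := boolP (v \in X).
    by rewrite /Z (setUidPr _) // sub1set.
  have gX : single v g \notin loc L' X.
    by apply/locP => -[_ /(_ v vX)/eqP]; rewrite singleE eqxx (negPf g0).
  have : (loc L' X + <[single v g]> <= loc L' Z)%VS.
    rewrite subv_add locS ?subsetUr // -memvE; apply/locP.
    split=> [|u]; first exact: single_red.
    by rewrite !inE negb_or singleE => /andP[/negPf->].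
  by move/dimvS; rewrite dimv_add1 // /Z cardsU1 vX; move: dX; dim_lia.
pose P := (loc L Z :&: perp v g)%VS.
have dP : (\dim (loc L' Z) <= (\dim P).+1)%N.
  have sub : (loc L' Z <= P + <[single v g]>)%VS.
    apply/subvP => x' /locP[/redP[x xL [xg xE]] x0].
    have xP : x \in P.
      rewrite memv_cap perpP xg eqxx andbT; apply/locP; split=> // u uZ.
      have uv : (u == v) = false by apply: contraNF uZ => /eqP->; rewrite setU11.
      by move: (x0 u uZ); case: xE => ->; rewrite // ffunE singleE uv addr0.
    case: xE => ->; first by apply: subvP (addvSl _ _) _ xP.
    by rewrite memv_add ?memv_line.
  apply: leq_trans (dimvS sub) _; apply: leq_trans (dimv_add_leqif _ _) _.
  by rewrite dim_vline; case: (_ != 0); rewrite ?addn0 ?addn1 // leqW.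
have sY : sep Y by apply: sepD1.
have dY := ge _ sY.
(* The count gives dim P > dim L_Y, so some [w] in [P] is outside L_Y and must equal [g] at [v].
   Such a value accounts for one dimension only, hence Y is itself a minimum cut. *)
have [sub|/subvPn[w wP wY]] := boolP (P <= loc L Y)%VS.
  by have := dimvS sub; move: dP dZ dY; rewrite cZ; dim_lia.
have [/locP[wL w0] wg] := memv_capP wP; rewrite perpP in wg.
have w0Y x : x \in L -> (forall u, u \notin Z -> x u = 0) -> x v = 0 -> x \in loc L Y.
  move=> xL x0 xv; apply/locP; split=> // u; rewrite !inE negb_and negbK.
  have [->//|uv /= uX] := eqVneq u v.
  by apply: x0; rewrite !inE negb_or uv.
have wv : w v = g.
  have [wv|//] := omega_parallel g0 (eqP wg).
  by rewrite w0Y in wY.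
exists Y, w; split => //; first last.
- apply/locP; split=> // u uZ; apply: w0; apply: contraNN uZ.
  by rewrite !inE => /orP[->//|uX]; rewrite uX; case: (u == v).
- by rewrite !inE eqxx.
split=> //; have : (\dim P <= (\dim (P :&: loc L Y)).+1)%N.
  apply: dimv_hyperplane wP _ => x /memv_capP[/locP[xL x0]].
  rewrite perpP => /eqP xg.
  have [xv|xv] := omega_parallel g0 xg; first by left; apply: w0Y.
  right; apply: w0Y => [|u uZ|]; first exact: memvB.
    by rewrite !ffunE x0 // w0 // subr0.
  by rewrite !ffunE xv wv subrr.
have := dimvS (capvSr P (loc L Y)); move: dP dZ; rewrite cZ; dim_lia.
Qed.

(** * Bad values under successive reductions *)

Lemma omega_neq0 g h : omega g h != 0 -> omega g h = 1.
Proof. by have [->|//] := F2_cases (omega g h); rewrite eqxx. Qed.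

(** A witness [w] not orthogonal to [h] at [u] forces u into X. If L_X were orthogonal to [h] at
    [u], then [single u h] would enlarge it and break the bound for the reduction. So some [x] in
    L_X pairs to 1 with [h] at [u], and [w - x] is a witness with the same value at [v]. *)
Lemma red_bad L v u g h : isotropic L -> u != v -> conn_ge (red L u h) ->
  bad L v g -> bad (red L u h) v g.
Proof.
move=> isoL uv ge [X [w [[sX mX] vX /locP[wL w0] wv]]].
have mX' : min_sep (red L u h) X.
  by split=> //; apply: leq_trans mX _; rewrite leq_add2r red_loc_mono.
have [wh | wh] := eqVneq (omega (w u) h) 0.
  exists X, w; split=> //; apply/locP; split=> //.
  by apply/redP; exists w => //; split; [|left].
have hL : single u h \notin L.
  by apply/negP => hL; rewrite -form_single isoL ?eqxx in wh.
have uX : u \in X.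
  apply: contraNT wh => uX; rewrite w0 ?omega0l //.
  by rewrite !inE negb_or uv.
have [sub|/subvPn[x xX]] := boolP (loc L X <= perp u h)%VS.
  have : (loc L X + <[single u h]> <= loc (red L u h) X)%VS.
    rewrite subv_add -memvE; apply/andP; split.
      apply/subvP => x xX; have /locP[xL x0] := xX; apply/locP; split=> //.
      by apply: subvP (cap_perp_red _ _ _) _ _; rewrite memv_cap xL (subvP sub).
    apply/locP; split=> [|z zX]; first exact: single_red.
    by rewrite singleE; case: eqP => // zu; rewrite zu uX in zX.
  move/dimvS; rewrite dimv_add1; last by apply: contra hL => /locP[].
  by have := ge X sX; move: mX; dim_lia.
rewrite perpP => /omega_neq0 xh; have /locP[xL x0] := xX.
exists X, (w - x); split=> //; last by rewrite !ffunE wv x0 // subr0.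
apply/locP; split=> [|z]; last first.
  move=> zZ; rewrite !ffunE w0 // x0 ?subr0 //.
  by apply: contraNN zZ; rewrite inE orbC => ->.
apply: subvP (cap_perp_red _ _ _) _ _; rewrite memv_cap memvB //= perpP !ffunE.
by rewrite omegaD -scaleN1r omegaZ xh (omega_neq0 wh) mulr1 subrr.
Qed.

Lemma red_conn_ge L v g : v \in D -> v \notin Q -> isotropic L -> g != 0 ->
  conn_ge L -> ~ bad L v g -> conn_ge (red L v g).
Proof.
move=> vD vQ isoL g0 ge nb X sX; rewrite leqNgt; apply/negP => lt.
have [] // := red_not_conn_ge vD vQ isoL g0 ge => /(_ X sX).
by rewrite leqNgt lt.
Qed.

Lemma red_conn_ge_choice L v : v \in D -> v \notin Q -> isotropic L ->
  conn_ge L -> exists2 g, g != 0 & conn_ge (red L v g).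
Proof.
move=> vD vQ isoL ge.
have n10 : (1, 0) != 0 :> K by rewrite xpair_eqE oner_eq0.
have n01 : (0, 1) != 0 :> K by rewrite xpair_eqE oner_eq0 andbF.
have nE : (1, 0) <> (0, 1) :> K by case=> /eqP; rewrite oner_eq0.
have nn : ~ (~ conn_ge (red L v (1, 0)) /\ ~ conn_ge (red L v (0, 1))).
  case=> /(red_not_conn_ge vD vQ isoL n10 ge)[b1 _].
  case/(red_not_conn_ge vD vQ isoL n01 ge)=> b2 _.
  by apply: nE; apply: bad_unique b1 b2.
(* A boolean form of the bound, so that the cases can be decided; two distinct values cannot both be
   bad. *)
pose T h := [forall X, sep X ==> (\dim (loc (red L v h) X) + k <= #|X|)%N].
have TP h : reflect (conn_ge (red L v h)) (T h).
  apply: (iffP forallP) => T' X; last exact/implyP/T'.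
  exact/implyP/T'.
have [/TP c|/TP n1] := boolP (T (1, 0)); first by exists (1, 0).
have [/TP c|/TP n2] := boolP (T (0, 1)); first by exists (0, 1).
by case: nn.
Qed.

(** Induction on [s]: a bad value other than [g] makes [g] harmless at a vertex of [A], and the bad
    values at the remaining vertices survive each reduction. The last two clauses describe the final
    space in terms of [L]: off [s] its members agree with members of [L] that obey every
    restriction. *)
Lemma reduce_all L (A : {set U}) g (s : seq U) :
    g != 0 -> lagrangian L -> conn_ge L ->
    {in A, forall v, exists e, [/\ e != 0, e != g & bad L v e]} ->
    uniq s -> {in s, forall v, v \in D :\: Q} ->
  exists (f : U -> K) (L' : {vspace vT}),
  [/\ lagrangian L' /\ conn_ge L',
      (forall v, f v != 0) /\ {in A, forall v, f v = g},
      {in s, forall v, single v (f v) \in L'},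
      (forall x, x \in L' -> exists2 y, y \in L &
         forall v, if v \in s then omega (y v) (f v) = 0 else y v = x v) &
      (forall y, y \in L -> {in s, forall v, omega (y v) (f v) = 0} -> y \in L')].
Proof.
move=> g0 lagL geL; elim: s L A lagL geL => [|u s IHs] L A lagL geL badA /=.
  move=> _ _; exists (fun=> g), L; split=> // x xL; first by exists x.
case/andP=> us uniq_s sD.
have [h [h0 hA geh]] : exists h : K, [/\ h != 0, u \in A -> h = g & conn_ge (red L u h)].
  have /setDP[uD uQ] := sD u (mem_head _ _).
  have [uA|uA] := boolP (u \in A); last first.
    by have [h h0 geh] := red_conn_ge_choice uD uQ lagL.1 geL; exists h.
  have [e [e0 eg be]] := badA u uA; exists g; split=> //.
  apply: (red_conn_ge uD uQ lagL.1 g0 geL) => bg.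
  by rewrite (bad_unique uD geL e0 g0 be bg) eqxx in eg.
have lagR := red_lagrangian u h lagL.
have badR : {in A :\ u, forall v, exists e, [/\ e != 0, e != g & bad (red L u h) v e]}.
  move=> v /setD1P[vu /badA[e [e0 eg be]]]; exists e; split=> //.
  by apply: red_bad lagL.1 _ geh be; rewrite eq_sym.
have sD' : {in s, forall v, v \in D :\: Q}.
  by move=> v vs; apply: sD; rewrite inE vs orbT.
have [f [L' [[lag' ge'] [f0 fA] sL' L'L LL']]] := IHs _ _ lagR geh badR uniq_s sD'.
have su v : v \in s -> (v == u) = false by apply: contraTF => /eqP->.
exists (fun v => if v == u then h else f v), L'; split=> //.
- split=> v; first by case: ifP.
  by case: eqVneq => [->|vu vA]; [|apply: fA; rewrite !inE vu].
- move=> v; rewrite inE; case: eqVneq => [-> _|_ /=]; last exact: sL'.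
  apply: LL' => [|w ws]; first exact: single_red.
  by rewrite singleE su // omega0l.
- move=> x /L'L[z /redP[y yL [yh yE]] xy]; exists y => // v.
  have := xy v; rewrite inE; case: eqVneq => [-> //|vu /=].
  by case: yE => ->; rewrite // ffunE singleE (negPf vu) addr0.
- move=> y yL yf; apply: LL' => [|v vs].
    apply/redP; exists y => //; split; last by left.
    by have := yf u (mem_head _ _); rewrite eqxx.
  by have := yf v; rewrite inE vs orbT su //; apply.
Qed.

(** * Splitting along a cut, and classes common to all minimum cuts *)

Definition split L X : {vspace vT} := (loc L X + loc L (~: X))%VS.

Lemma restrict_supp X x : restrict X x \in supp X.
Proof. by apply/suppP => v /negPf vX; rewrite ffunE vX. Qed.

Lemma splitP L X x : reflect (x \in L /\ restrict X x \in L) (x \in split L X).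
Proof.
apply: (iffP memv_addP) => [[a /locP[aL a0] [b /locP[bL b0] ->]] | [xL rL]].
  split; first exact: memvD.
  suff -> : restrict X (a + b) = a by [].
  apply/ffunP => v; rewrite !ffunE; case: ifPn => [vX|/a0 //].
  by rewrite b0 ?addr0 // inE vX.
exists (restrict X x); first by rewrite memv_cap rL restrict_supp.
exists (x - restrict X x); last by rewrite addrC subrK.
apply/locP; split=> [|v]; first exact: memvB.
by rewrite inE negbK !ffunE => ->; rewrite subrr.
Qed.

(** The codimension of [split L X] in [L] is thus twice the cut-rank |X| - dim L_X. *)
Lemma split_dim L X : lagrangian L ->
  (\dim (split L X) + (#|X| + #|X|) = #|U| + (\dim (loc L X) + \dim (loc L X)))%N.
Proof.
move=> lagL; rewrite dimv_disjoint_sum.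
  by have := loc_setC X lagL; have := cardsC X; dim_lia.
apply/eqP; rewrite -subv0; apply/subvP => x /memv_capP[/locP[_ x0] /locP[_ x1]].
rewrite memv0; apply/eqP/ffunP => v; rewrite ffunE.
by have [vX|/x0//] := boolP (v \in X); rewrite x1 // inE vX.
Qed.

(** [H] consists of the members of [L] obeying a restriction at every vertex of [D :\: Q], with
    value [g] on [A]. The quotient H / N is the space of classes; [N] is defined through the reduced
    space, hence without reference to a particular minimum cut. *)
Lemma frame_classes L (A : {set U}) g :
    g != 0 -> lagrangian L -> conn_ge L -> Q \subset D -> A \subset D :\: Q ->
    {in A, forall v, exists e, [/\ e != 0, e != g & bad L v e]} ->
  exists H N : {vspace vT},
  [/\ (H <= L)%VS, (N <= H)%VS,
      {in H & A, forall x v, x v = 0 \/ x v = g} &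
      forall X, min_sep L X -> [/\ (\dim H <= \dim N + (k + k))%N,
         (L <= H + split L X)%VS & (H :&: split L X = N)%VS]].
Proof.
move=> g0 lagL geL QD AD badA; pose s := enum (D :\: Q).
have memS v : (v \in s) = (v \in D :\: Q) by rewrite mem_enum.
have [||f [L' [[lagL' geL'] [f0 fA] fL' L'L LL']]] :=
  reduce_all (s := s) g0 lagL geL badA; [exact: enum_uniq|by move=> v; rewrite memS|].
have par x v : x \in L' -> v \in D :\: Q -> x v = 0 \/ x v = f v.
  move=> xL' vD; apply: omega_parallel => //.
  by rewrite -form_single lagL'.1 // fL' // memS.
(* Such a vector is a sum of vectors [single v (f v)], all of which are in [L']. *)
have inL' x : x \in supp (D :\: Q) -> (forall v, v \in D :\: Q -> x v = 0 \/ x v = f v) ->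
    x \in L'.
  move=> /suppP x0 xf; have -> : x = \sum_(v in D :\: Q) single v (x v).
    apply/ffunP => u; rewrite sum_ffunE; have [uD|uD] := boolP (u \in D :\: Q).
      rewrite (bigD1 u) //= big1 ?addr0 ?singleE ?eqxx // => v /andP[_ /negPf vu].
      by rewrite singleE eq_sym vu.
    rewrite x0 // big1 // => v vD; rewrite singleE; case: eqP => // uv.
    by rewrite uv vD in uD.
  apply: memv_suml => v vD; have [->|->] := xf v vD; last by rewrite fL' // memS.
  suff -> : single v 0 = 0 by apply: mem0v.
  by apply/ffunP => u; rewrite singleE ffunE if_same.
(* The restrictions of a member of [L'] to X and to Q differ by a vector on [X :\: Q], which is in
   [L']. *)
have splitQ X : sep X -> split L' X = split L' Q.
  move=> /andP[QX XD]; apply/vspaceP => x.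
  have xE : restrict X x = restrict Q x + restrict (X :\: Q) x.
    apply/ffunP => v; rewrite !ffunE inE.
    have [vQ|vQ] := boolP (v \in Q); first by rewrite (subsetP QX) // addr0.
    by rewrite add0r.
  have xL' : x \in L' -> restrict (X :\: Q) x \in L'.
    move=> xL; apply: inL' => [|v vD].
      apply/suppP => v vD; rewrite ffunE; case: ifP => // vX; case/negP: vD.
      by move: vX; rewrite !inE => /andP[-> /(subsetP XD)].
    by rewrite ffunE; case: ifP => _; [apply: par | left].
  apply/splitP/splitP => -[xL]; rewrite xE => rL; split=> //; last first.
    by rewrite memvD ?xL'.
  by rewrite -[restrict Q x](addrK (restrict (X :\: Q) x)) memvB ?xL'.
pose H := (L :&: L')%VS; pose N := (H :&: split L' Q)%VS.
exists H, N; split; [exact: capvSl | exact: capvSl | |].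
  move=> x v /memv_capP[_ xL'] vA; rewrite -(fA v vA); apply: par => //.
  exact: (subsetP AD).
(* A member of [L'] agrees on Q with a member of [H]; their difference vanishes on Q and so splits
   trivially. *)
have HL' : (H + split L' Q = L')%VS.
  apply/eqP; rewrite eqEsubv subv_add capvSr subv_add !capvSl /=.
  apply/subvP => x xL'; have [y yL yx] := L'L x xL'.
  have yL' : y \in L' by apply: LL' => // v vs; have := yx v; rewrite vs.
  rewrite -[x](subrK y) addrC memv_add //; first by rewrite memv_cap yL.
  apply/splitP; split; first exact: memvB.
  suff -> : restrict Q (x - y) = 0 by apply: mem0v.
  apply/ffunP => v; rewrite !ffunE; case: ifP => // vQ.
  by have := yx v; rewrite memS inE vQ /= => ->; rewrite subrr.
have sQ : sep Q by rewrite /sep subxx.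
have dN : (\dim N + (k + k) <= \dim H)%N.
  have := dimv_sum_cap H (split L' Q); rewrite HL' lagL'.2 -/N.
  have := split_dim Q lagL'; have := geL' _ sQ; dim_lia.
move=> X [sX mX].
have sub : (H :&: split L X <= N)%VS.
  apply/subvP => y /memv_capP[yH /splitP[yL rL]].
  rewrite memv_cap yH -(splitQ X sX); have [_ yL'] := memv_capP yH.
  apply/splitP; split=> //; apply: LL' => // v; rewrite memS => vD.
  rewrite ffunE; case: ifP => _; last exact: omega0l.
  by have [->|->] := par _ _ yL' vD; rewrite ?omega0l ?omegapp.
have subL : (H + split L X <= L)%VS by rewrite !subv_add !capvSl.
(* By [dN], dim H - dim N is at least 2k, whereas [split L X] has codimension at most 2k in [L]
   because X is a minimum cut. All inequalities in between are therefore equalities. *)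
have d1 := dimvS sub; have d2 := dimvS subL; rewrite lagL.2 in d2.
have d3 := dimv_sum_cap H (split L X); have d4 := split_dim X lagL.
split.
- by move: dN mX d1 d2 d3 d4; dim_lia.
- have -> // : (H + split L X = L)%VS; apply/eqP; rewrite eqEdim subL lagL.2.
  by move: dN mX d1 d2 d3 d4; dim_lia.
- apply/eqP; rewrite eqEdim sub.
  by move: dN mX d1 d2 d3 d4; dim_lia.
Qed.

(** * Submodularity and the lattice of minimum cuts *)

Lemma loc_submod L X Y :
  (\dim (loc L X) + \dim (loc L Y) <= \dim (loc L (X :&: Y)) + \dim (loc L (X :|: Y)))%N.
Proof.
rewrite -dimv_sum_cap -locI addnC leq_add2l; apply: dimvS.
by rewrite subv_add !locS ?subsetUl ?subsetUr.
Qed.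

Lemma min_sepUI L X Y : conn_ge L -> min_sep L X -> min_sep L Y ->
  min_sep L (X :&: Y) /\ min_sep L (X :|: Y).
Proof.
move=> ge [sX mX] [sY mY]; have sI := sepI sX sY; have sU := sepU sX sY.
have gI := ge _ sI; have gU := ge _ sU; have sub := loc_submod L X Y.
by split; split=> //; have := cardsUI X Y; move: mX mY gI gU sub; dim_lia.
Qed.

(** The witness is nonzero at [v], hence outside L_X, and pays for the added vertex with one
    dimension. *)
Lemma bad_min_sep L v g : v \in D -> g != 0 -> bad L v g ->
  exists X, [/\ min_sep L X, v \notin X & min_sep L (v |: X)].
Proof.
move=> vD g0 [X [w [[sX mX] vX wX wv]]]; exists X; split=> //.
split; first exact: sepU1.
have wX' : w \notin loc L X by apply: contra g0 => /locP[_ /(_ v vX)]; rewrite -wv => ->.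
have : (loc L X + <[w]> <= loc L (v |: X))%VS.
  by rewrite subv_add locS ?subsetUr // -memvE.
by move/dimvS; rewrite dimv_add1 // cardsU1 vX; move: mX; dim_lia.
Qed.

(* By induction, the interval from [Z] to [Y] is refined into steps that add one
   vertex of [A]; at such a step a nonzero [x v] would be bad, hence equal to [e v]. *)
Lemma restrict_in_zero L (A : {set U}) (e : U -> K) x Y (Z : {set U}) :
    conn_ge L -> Q \subset D -> A \subset D ->
    {in A, forall v, [/\ e v != 0, bad L v (e v) & x v <> e v]} ->
    {in (D :\: Q) :\: A, forall v, x v = 0} ->
    Z \subset Y -> min_sep L Z -> min_sep L Y -> restrict Y x \in L ->
  restrict Z x \in L /\ {in A :&: (Y :\: Z), forall v, x v = 0}.
Proof.
move=> ge QD AD badA x0.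
have [m] := ubnP #|A :&: (Y :\: Z)|; elim: m Y Z => // m IHm Y Z lt_m ZY mZ mY rY.
have [B0 | [v vB]] := set_0Vmem (A :&: (Y :\: Z)).
  split; last by rewrite B0 => v; rewrite inE.
  suff -> : restrict Z x = restrict Y x by [].
  apply/ffunP => v; rewrite !ffunE; have [vZ|vZ] := boolP (v \in Z).
    by rewrite (subsetP ZY).
  case: ifP => // vY; rewrite x0 // !inE.
  have [/andP[QZ _] [/andP[_ YD] _]] := (mZ.1, mY).
  rewrite (subsetP YD) // (contra (subsetP QZ v) vZ) !andbT.
  apply/negP => vA; have : v \in A :&: (Y :\: Z) by rewrite !inE vA vZ.
  by rewrite B0 inE.
have /setIP[vA /setDP[vY vZ]] := vB; have vD := subsetP AD v vA.
have [e0 bv xv] := badA v vA.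
have [X [mX vX mvX]] := bad_min_sep vD e0 bv.
(* Lattice operations move the minimum cuts X and X + v between Z and Y, where they still differ by
   [v] alone. *)
pose Z1 := Z :|: Y :&: X; pose Z2 := v |: Z1.
have Z2E : Z2 = Z :|: Y :&: (v |: X).
  apply/setP => u; rewrite !inE; case: eqVneq => [->|_] //=; by rewrite vY orbT.
have mZ1 : min_sep L Z1 by apply min_sepUI => //; apply min_sepUI.
have mZ2 : min_sep L Z2 by rewrite Z2E; apply min_sepUI => //; apply min_sepUI.
have Z1Y : Z1 \subset Y by rewrite subUset ZY subsetIl.
have Z2Y : Z2 \subset Y by rewrite subUset sub1set vY.
have ZZ1 : Z \subset Z1 by apply: subsetUl.
have vZ1 : v \notin Z1 by rewrite !inE negb_or negb_and vZ vX orbT.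
have [|rZ2 x2] := IHm Y Z2 _ Z2Y mZ2 mY rY.
  rewrite -ltnS (leq_trans _ lt_m) // ltnS; apply: proper_card; apply/properP; split.
    by apply: setIS; apply: setDS; apply: subset_trans ZZ1 _; apply: subsetUr.
  by exists v => //; rewrite !inE eqxx /= andbF.
(* The restriction of [x] to [Z2] is in [L] and would make a nonzero [x v] bad at [v], hence equal
   to [e v]. *)
have xv0 : x v = 0.
  apply/eqP/negPn/negP => xv0; apply: xv.
  apply: bad_unique vD ge xv0 e0 _ bv; exists Z1, (restrict Z2 x); split=> //.
    by rewrite memv_cap rZ2 restrict_supp.
  by rewrite ffunE setU11.
have rZ1 : restrict Z1 x \in L.
  suff -> : restrict Z1 x = restrict Z2 x by [].
  apply/ffunP => u; rewrite !ffunE in_setU1.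
  by case: eqVneq => // ->; rewrite xv0 if_same.
have [|rZ xZ] := IHm Z1 Z _ ZZ1 mZ mZ1 rZ1.
  rewrite -ltnS (leq_trans _ lt_m) // ltnS; apply: proper_card; apply/properP; split.
    by apply: setIS; apply: setSD.
  by exists v => //; rewrite !inE in vZ1 *; rewrite (negPf vZ1) !andbF.
split=> // u /setIP[uA /setDP[uY uZ]].
have [->//|uv] := eqVneq u v.
have [uZ1|uZ1] := boolP (u \in Z1); first by apply: xZ; rewrite in_setI uA in_setD uZ.
by apply: x2; rewrite in_setI uA in_setD uY in_setU1 negb_or uv uZ1.
Qed.

(** Each [v] in [A] is missed by a minimum cut X, so the descent from Y to X :&: Y passes [v]. *)
Lemma split_zero L (A : {set U}) (e : U -> K) x :
    conn_ge L -> Q \subset D -> A \subset D ->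
    {in A, forall v, [/\ e v != 0, bad L v (e v) & x v <> e v]} ->
    {in (D :\: Q) :\: A, forall v, x v = 0} ->
  forall Y, min_sep L Y -> A \subset Y -> restrict Y x \in L -> {in A, forall v, x v = 0}.
Proof.
move=> ge QD AD badA x0 Y mY AY rY v vA; have vD := subsetP AD v vA.
have [e0 bv xv] := badA v vA; have [X [mX vX mvX]] := bad_min_sep vD e0 bv.
have [mXY _] := min_sepUI ge mX mY.
have [_] := restrict_in_zero ge QD AD badA x0 (subsetIr _ _) mXY mY rY; apply.
by rewrite !inE vA (subsetP AY) // (negPf vX).
Qed.

(** Every vertex of [A] lies in some minimum cut by [bad_min_sep], and minimum cuts are closed under
    union. *)
Lemma min_sep_cover L (A : {set U}) (e : U -> K) :
    conn_ge L -> A \subset D -> (exists X, min_sep L X) ->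
    {in A, forall v, e v != 0 /\ bad L v (e v)} ->
  exists2 Y, min_sep L Y & A \subset Y.
Proof.
move=> ge AD [X mX] badA.
suff [Y mY sY] : exists2 Y, min_sep L Y & {subset enum A <= Y}.
  by exists Y => //; apply/subsetP => v vA; apply: sY; rewrite mem_enum.
have : {subset enum A <= A} by move=> v; rewrite mem_enum.
elim: (enum A) => [|v s IHs] sA; first by exists X.
have [|Y mY sY] := IHs; first by move=> u us; apply: sA; rewrite inE us orbT.
have vA := sA v (mem_head _ _); have [e0 bv] := badA v vA.
have [Z [mZ vZ mvZ]] := bad_min_sep (subsetP AD v vA) e0 bv.
exists (Y :|: (v |: Z)); first by apply min_sepUI.
by move=> u; rewrite !inE => /orP[->|/sY->]; rewrite ?orbT.
Qed.

End Separations.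

(** * Two pairs of terminals *)

Lemma pigeonhole (I T : finType) (A : {set I}) (B : {set T}) (h : I -> T) (m : nat) :
    {in A, forall i, h i \in B} -> (m * #|B| < #|A|)%N ->
  exists2 b, b \in B & (m < #|[set i in A | h i == b]|)%N.
Proof.
move=> hB lt; have [/exists_inP[b bB hb]|none] :=
  boolP [exists b in B, (m < #|[set i in A | h i == b]|)%N]; first by exists b.
have: (#|A| <= m * #|B|)%N; last by rewrite leqNgt lt.
rewrite -sum1_card (partition_big h (mem B)) //= mulnC -sum_nat_const.
apply: leq_sum => b bB; rewrite sum1dep_card leqNgt.
by apply: contra none => lt_m; apply/exists_inP; exists b.
Qed.

(* A value of [h] is the class of a vertex in [H / N], which has at most
   [4 ^ k - 1] nonzero elements; [x0] is a class taken more than [m] times. *)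
Lemma bad_family (Q D : {set U}) (k m : nat) L (A : {set U}) g (e : U -> K) :
    g != 0 -> lagrangian L -> conn_ge Q D k L -> Q \subset D -> A \subset D :\: Q ->
    {in A, forall v, [/\ e v != 0, e v != g, bad Q D k L v (e v) &
                         single v (e v) \notin L]} ->
    (m * (2 ^ (k + k)).-1 < #|A|)%N ->
  exists (x0 : vT) (J : {set U}),
  [/\ J \subset A, (m < #|J|)%N, {in A, forall v, x0 v = 0 \/ x0 v = g},
      {in J, forall v, x0 v = 0} &
      {in J, forall v, exists X, [/\ sep Q D X, v \notin X &
        restrict X x0 + single v (e v) \in L]}].
Proof.
move=> g0 lagL ge QD AD badA lt_m.
have [|H [N [HL NH Hg HN]]] := frame_classes g0 lagL ge QD AD.
  by move=> v /badA[e0 eg bv _]; exists (e v).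
(* [C] is a complement of [N] in [H]: it holds one representative of each class, and [pi] selects
   it. *)
pose C := (H :\: N)%VS; pose pi := daddv_pi C N.
have CN0 : (C :&: N = 0)%VS by apply: capv_diff.
have CNH : (C + N)%VS = H by rewrite addv_diff; apply/addv_idPl.
have piN x : x \in H -> x - pi x \in N.
  rewrite -CNH => xH; rewrite -[x in x - _](daddv_pi_add CN0 xH) addrAC subrr add0r.
  exact: memv_pi.
have repr v : exists x : vT, v \in A -> exists X, [/\ x \in C, sep Q D X, v \notin X &
    restrict X x + single v (e v) \in L].
  have [vA|vA] := boolP (v \in A); last by exists 0.
  have [_ _ [X [w [mX vX /locP[wL w0] wv]]] _] := badA v vA.
  have [_ LHX HXN] := HN X mX.
  have /memv_addP[y yH [z zX wE]] := subvP LHX w wL.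
  exists (pi y) => _; exists X; split=> //; [exact: memv_pi | exact: mX.1 |].
  (* Replacing y by its representative changes it by a member of [N], which splits along X.
     Subtracting from [w] the X-part of [w - pi y] leaves the required vector. *)
  have /splitP[_ rL] : w - pi y \in split L X.
    rewrite wE addrAC memvD //.
    by have := piN y yH; rewrite -HXN => /memv_capP[].
  suff -> : restrict X (pi y) + single v (e v) = w - restrict X (w - pi y).
    exact: memvB.
  apply/ffunP => u; rewrite !ffunE; case: eqVneq => [->|uv].
    by rewrite (negPf vX) add0r subr0 wv.
  case: ifPn => uX; first by rewrite addr0 opprB addrC subrK.
  by rewrite subr0 addr0 w0 // !inE negb_or uv.
have [h hA] := fin_all_exists repr.
have CH x : x \in C -> x \in H by apply: subvP (diffvSl _ _) x.
pose B := [set x : vT in C | x != 0].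
have cB : (#|B| <= (2 ^ (k + k)).-1)%N.
  have [v vA] : exists v, v \in A.
    by apply/set0Pn; rewrite -card_gt0; apply: leq_trans lt_m.
  have [_ _ [X [_ [mX _ _ _]]] _] := badA v vA; have [dH _ _] := HN X mX.
  have dC : (\dim C <= k + k)%N.
    have := dimv_disjoint_sum CN0; rewrite CNH; move: dH; dim_lia.
  have : (#|[set x : vT in C]| <= 2 ^ (k + k))%N.
    by rewrite cardsE card_vspace cardF leq_exp2l.
  have sB : B \subset [set x : vT in C] :\ (0 : vT).
    by apply/subsetP => x; rewrite !inE andbC.
  move: (subset_leq_card sB); have := cardsD1 (0 : vT) [set x : vT in C].
  by rewrite inE mem0v; have := expn_gt0 2 (k + k); dim_lia.
have [||x0] := pigeonhole (A := A) (B := B) (h := h) (m := m).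
(* A zero class would put [single v (e v)] itself in [L]. *)
- move=> v vA; have [X [hC _ _ rL]] := hA v vA; rewrite inE hC /=.
  have [_ _ _] := badA v vA; apply: contraNneq => h0; move: rL; rewrite h0.
  by rewrite linear0 add0r.
- by apply: leq_ltn_trans lt_m; rewrite leq_mul2l cB orbT.
rewrite inE => /andP[x0C _] lt_J; pose J := [set v in A | h v == x0].
have JA : J \subset A by apply/subsetP => v; rewrite inE => /andP[].
have x0A : {in A, forall v, x0 v = 0 \/ x0 v = g}.
  by move=> v vA; apply: Hg => //; apply: CH.
have x0J : {in J, forall v, exists X, [/\ sep Q D X, v \notin X &
        restrict X x0 + single v (e v) \in L]}.
  move=> v; rewrite inE => /andP[vA /eqP <-].
  by have [X [_ sX vX rL]] := hA v vA; exists X.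
exists x0, J; split=> // v vJ; have vA := subsetP JA v vJ.
have [X [_ _ rL]] := x0J v vJ; have [e0 eg _ _] := badA v vA.
have [//|xg] := x0A v vA.
have x0L : x0 \in L by apply: subvP HL _ _; apply: CH.
(* Pairing [x0] with the vector of [v] leaves only the term at [v], so [x0 v] is orthogonal to
   [e v]. Being 0 or [g], and [g] differing from [e v], it is 0. *)
have xx : form x0 (restrict X x0) = 0.
  rewrite -(form_restrict x0 (restrict_supp X x0)) /form big1 // => u _.
  exact: omegapp.
have := lagL.1 _ _ x0L rL; rewrite formDr form_single xg xx add0r => ge0.
have [eq0|eqg] := omega_parallel e0 ge0.
  by rewrite eq0 eqxx in g0.
by rewrite eqg eqxx in eg.
Qed.

Lemma sum_parallel (V : lmodType F) (I : finType) (P : pred I) (h : I -> V) (t : V) :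
  (forall i, P i -> h i = 0 \/ h i = t) ->
  \sum_(i | P i) h i = 0 \/ \sum_(i | P i) h i = t.
Proof.
move=> hP; elim/big_ind: _ => [|x y xt yt|//]; first by left.
by case: xt yt => -> [] ->; rewrite ?addr0 ?add0r ?F2_addvv; [left|right|right|left].
Qed.

(** The space [W] is too large to avoid the members of [L] that split along a minimum (S,T)-cut. A
    common nonzero member must vanish on [A], although members of [W] are determined by their values
    on a subset of [A]. *)
Lemma conflict_bound (Q D S E : {set U}) (k l : nat) L g (e e' : U -> K)
    (A := (D :\: Q) :&: (E :\: S)) :
    g != 0 -> lagrangian L -> Q \subset D -> S \subset E ->
    conn_ge Q D k L -> conn_ge S E l L -> (exists Y, min_sep S E l L Y) ->
    {in A, forall v, [/\ e v != 0, e v != g, bad Q D k L v (e v) &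
                         single v (e v) \notin L]} ->
    {in A, forall v, [/\ e' v != 0, e' v != g, e' v != e v & bad S E l L v (e' v)]} ->
  (#|A| < (2 * l + 1) * 2 ^ (2 * k))%N.
Proof.
move=> g0 lagL QD SE geQ geS mS badA badA'; rewrite ltnNge; apply/negP => le_A.
(* With 4^k - 1 classes available, more than 2l + 1 vertices share one. *)
have [||x0 [J [JA lt_J x0A x0J0 x0J]]] :=
    @bad_family Q D k (2 * l + 1) L A g e g0 lagL geQ QD _ badA.
- exact: subsetIl.
- apply: leq_trans le_A; rewrite ltn_pmul2l ?addn1 // mul2n -addnn.
  by rewrite prednK ?expn_gt0.
pose goodX v X := [/\ sep Q D X, v \notin X & restrict X x0 + single v (e v) \in L].
have [X XJ] : exists X : U -> {set U}, forall v, v \in J -> goodX v (X v).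
  apply: (@fin_all_exists U (fun=> {set U}) (fun v X => v \in J -> goodX v X)) => v.
  have [vJ|vJ] := boolP (v \in J); last by exists set0.
  by have [X ?] := x0J v vJ; exists X.
have [i0 i0J] : exists i0, i0 \in J.
  by apply/set0Pn; rewrite -card_gt0; apply: leq_trans lt_J.
pose w i := restrict (X i) x0 + single i (e i); pose u i := w i + w i0.
have wL i : i \in J -> w i \in L by case/XJ.
have wJ i j : i \in J -> j \in J -> w i j = if j == i then e i else 0.
  by move=> iJ jJ; rewrite !ffunE (x0J0 j jJ) if_same add0r.
have w_out i v : i \in J -> v \notin J -> w i v = 0 \/ w i v = x0 v.
  move=> iJ vJ; rewrite !ffunE.
  have -> : (v == i) = false by apply: contraNF vJ => /eqP->.
  by case: ifP => _; rewrite addr0; [right|left].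
(* On Q both summands equal [x0] and cancel; outside D both vanish. *)
have u0 i v : i \in J -> v \notin D :\: Q -> u i v = 0.
  move=> iJ vDQ; have vJ j : j \in J -> (v == j) = false.
    move=> jJ; apply: contraNF vDQ => /eqP->.
    by have /setIP[] := subsetP JA j jJ.
  rewrite !ffunE !vJ // !addr0; have [/andP[QX XD] _ _] := XJ i iJ.
  have [/andP[QX0 XD0] _ _] := XJ i0 i0J.
  have [vQ|vQ] := boolP (v \in Q); first by rewrite !(subsetP QX, subsetP QX0) ?F2_addvv.
  have vD : v \notin D by move: vDQ; rewrite inE vQ.
  by rewrite !ifN ?addr0 // (contraNN _ vD) //; apply/subsetP.
pose J' := J :\ i0; pose W := (\sum_(i in J') <[u i]>)%VS.
have J'J i : i \in J' -> i \in J by case/setD1P.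
have uJ i j : i \in J' -> j \in J' -> u i j = if j == i then e i else 0.
  move=> /J'J iJ /setD1P[ji0 jJ].
  by rewrite ffunE !wJ // (negPf ji0) addr0.
have scale (a : vT) i v t : a \in <[u i]>%VS ->
    u i v = 0 \/ u i v = t -> a v = 0 \/ a v = t.
  case/vlineP => b ->; have [->|->] := F2_scale b (u i) => //.
  by move=> _; left; rewrite ffunE.
(* On [J'], the vector [u i] is nonzero exactly at i, so these vectors are independent. *)
have dW : (\dim W = #|J'|)%N.
  have /directvP : directv (\sum_(i in J') <[u i]>)%VS.
    apply/directv_sum_independent => us usW sum0 i iJ'.
    have := congr1 (fun x : vT => x i) sum0; rewrite sum_ffunE [RHS]ffunE.
    rewrite (bigD1 i) //= big1 => [|j /andP[jJ' ji]].
      have /vlineP[b ->] := usW i iJ'; have [->//|->] := F2_scale b (u i).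
      rewrite addr0 uJ // eqxx => ei0.
      by have [] := badA i (subsetP JA _ (J'J _ iJ')); rewrite ei0 eqxx.
    have [||//|//] := scale (us j) j i 0; first exact: usW.
    by left; rewrite uJ // eq_sym (negPf ji).
  rewrite /= -/W => ->; rewrite -sum1_card; apply: eq_bigr => i iJ'; rewrite dim_vline.
  have -> // : u i != 0; apply/eqP => ui0; have := uJ i i iJ' iJ'; rewrite ui0 ffunE eqxx.
  by move=> ei0; have [] := badA i (subsetP JA _ (J'J _ iJ')); rewrite -ei0 eqxx.
have WL : (W <= L)%VS.
  by apply/subv_sumP => i iJ'; rewrite -memvE memvD ?wL // J'J.
have [||Y mY AY] := @min_sep_cover S E l L A e' geS _ mS.
- by apply: subset_trans (subsetIr _ _) _; apply: subsetDl.
- by move=> v /badA'[e0 _ _ be].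
(* [W] has dimension at least 2l + 1 and [split L Y] has codimension at most 2l in [L]. *)
have /eqP : (W :&: split L Y)%VS <> 0%VS.
  move=> WY0; have := dimv_disjoint_sum WY0.
  have : (\dim (W + split L Y) <= #|U|)%N.
    by rewrite -lagL.2; apply: dimvS; rewrite subv_add WL subv_add !capvSl.
  have := split_dim Y lagL; have := mY.2; move: lt_J; rewrite dW (cardsD1 i0 J) i0J -/J'.
  by dim_lia.
rewrite -vpick0; set x := vpick _ => xn0.
have /memv_capP[xW /splitP[xL rL]] : x \in (W :&: split L Y)%VS by apply: memv_pick.
have /memv_sumP[us usW xE] := xW.
have par v t : (forall i, i \in J' -> u i v = 0 \/ u i v = t) -> x v = 0 \/ x v = t.
  move=> ut; rewrite xE sum_ffunE; apply: sum_parallel => i iJ'.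
  by apply: scale (usW i iJ') (ut i iJ').
(* At v in A, [x v] is 0 or [e v] if v is in J, and 0 or [g] otherwise; it is never [e' v], so
   [split_zero] applies. *)
have xA : {in A, forall v, x v = 0}.
  have AE : A \subset E by apply: subset_trans (subsetIr _ _) (subsetDl _ _).
  apply: (split_zero (e := e') geS SE AE _ _ mY AY rL) => v vA.
    have [e0 eg ee be] := badA' v vA; split=> //.
    have [vJ|vJ] := boolP (v \in J).
      have [i iJ'|->|->] := par v (e v) _; last 2 first.
      - by move=> e'0; rewrite -e'0 eqxx in e0.
      - by move=> e'e; rewrite e'e eqxx in ee.
      have iJ := J'J i iJ'; rewrite ffunE !wJ //.
      case: eqVneq => [->|_]; case: eqVneq => [->|_]; rewrite ?F2_addvv ?addr0 ?add0r;
        by [left|right].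
    have [i iJ'|->|->] := par v g _; last 2 first.
    - by move=> e'0; rewrite -e'0 eqxx in e0.
    - by move=> e'g; rewrite e'g eqxx in eg.
    rewrite ffunE; have [xg|xg] := x0A v vA.
      by have [->|->] := w_out i v (J'J _ iJ') vJ; have [->|->] := w_out i0 v i0J vJ;
         rewrite ?xg addr0; left.
    by have [->|->] := w_out i v (J'J _ iJ') vJ; have [->|->] := w_out i0 v i0J vJ;
       rewrite ?xg ?F2_addvv ?addr0 ?add0r; [left|right|right|left].
  have vDQ : v \notin D :\: Q.
    by apply: contraL vA => vDQ; rewrite inE in_setI vDQ; case: (v \in E :\: S).
  by have [|//|//] := par v 0 _; move=> i iJ'; left; apply: u0; first exact: J'J.
case/eqP: xn0; rewrite xE; apply: big1 => i iJ'.
have iA := subsetP JA _ (J'J _ iJ'); have := xA i iA; rewrite xE sum_ffunE.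
rewrite (bigD1 i) //= big1 => [|j /andP[jJ' ji]].
  have /vlineP[b ->] := usW i iJ'; have [->//|->] := F2_scale b (u i).
  rewrite addr0 uJ // eqxx => ei0.
  by have [] := badA i iA; rewrite ei0 eqxx.
have [||//|//] := scale (us j) j i 0; first exact: usW.
by left; rewrite uJ // eq_sym (negPf ji).
Qed.

(** The reduction does not shrink L_X; removing [v] from X then costs one dimension at most, against
    one vertex. *)
Lemma red_min_sep (Q D : {set U}) (k : nat) L X v g :
    isotropic L -> g != 0 -> min_sep Q D k L X ->
  (#|X :\ v| <= \dim (loc (red L v g) (X :\ v)) + k)%N.
Proof.
move=> isoL g0 [_ mX]; have mono := red_loc_mono X v g isoL.
have [vX|vX] := boolP (v \in X); last first.
  have -> : X :\ v = X by apply/setDidPl; rewrite disjoint_sym disjoints1.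
  by apply: leq_trans mX _; rewrite leq_add2r.
have gR : single v g \in loc (red L v g) X.
  apply/locP; split=> [|u uX]; first exact: single_red.
  by rewrite singleE; case: eqP => // uv; rewrite uv vX in uX.
have : (\dim (loc (red L v g) X) <=
        (\dim (loc (red L v g) X :&: loc (red L v g) (X :\ v))).+1)%N.
  apply: dimv_hyperplane gR _ => x /locP[xR x0].
  have inX' z : z \in red L v g -> (forall u, u \notin X -> z u = 0) -> z v = 0 ->
      z \in loc (red L v g) (X :\ v).
    move=> zR z0 zv; apply/locP; split=> // u; rewrite !inE negb_and negbK.
    by case/orP => [/eqP->//|/z0].
  have [xv|xv] : x v = 0 \/ x v = g.
    apply: omega_parallel => //; rewrite -form_single.
    by apply: red_isotropic xR (single_red _ _ _).
    by left; apply: inX'.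
  right; apply: inX' => [|u uX|]; first by rewrite memvB ?single_red.
    rewrite !ffunE x0 // add0r; case: eqP => [uv|_]; last exact: oppr0.
    by rewrite uv vX in uX.
  by rewrite !ffunE eqxx xv subrr.
have := dimvS (capvSr (loc (red L v g) X) (loc (red L v g) (X :\ v))).
by have := cardsD1 v X; rewrite vX; move: mX mono; dim_lia.
Qed.

(** * The Lagrangian space of a graph *)

Implicit Type G : graph U.

Definition nbr_sum G (x : {ffun U -> F^o}) v : F := \sum_w (adj G v w)%:R * (x w : F).

Lemma nbr_sum_linear G (a : F) (x y : {ffun U -> F^o}) v :
  nbr_sum G (a *: x + y) v = a * nbr_sum G x v + nbr_sum G y v.
Proof.
rewrite /nbr_sum mulr_sumr -big_split; apply: eq_bigr => w _ /=.
by rewrite mulrCA -mulrDr !ffunE.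
Qed.

Definition graph_vec G (x : {ffun U -> F^o}) : vT :=
  [ffun v => (x v, nbr_sum G x v : F^o)].

Lemma graph_vecE G (x : {ffun U -> F^o}) v : graph_vec G x v = (x v, nbr_sum G x v).
Proof. exact: ffunE. Qed.

Lemma graph_vec_linear G : linear (graph_vec G).
Proof.
by move=> a x y; apply/ffunP => v; rewrite !ffunE nbr_sum_linear.
Qed.
HB.instance Definition _ G :=
  GRing.isLinear.Build F {ffun U -> F^o} vT _ (graph_vec G) (graph_vec_linear G).

Definition graph_space G : {vspace vT} := limg (linfun (graph_vec G)).

Definition fst_vec (x : vT) : {ffun U -> F^o} := [ffun v => (x v).1].

Lemma graph_spaceP G x :
  reflect (forall v, (x v).2 = nbr_sum G (fst_vec x) v) (x \in graph_space G).
Proof.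
apply: (iffP memv_imgP) => [[y _ ->] v | xG].
  by rewrite lfunE /= ffunE /=; apply: eq_bigr => w _; rewrite !ffunE.
exists (fst_vec x); first exact: memvf.
rewrite lfunE; apply/ffunP => v; rewrite ffunE -xG ffunE.
by case: (x v).
Qed.

Lemma graph_isotropic G : isotropic (graph_space G).
Proof.
move=> x y /graph_spaceP xG /graph_spaceP yG.
rewrite /form /omega big_split /=.
have -> : \sum_v (x v).1 * (y v).2 = \sum_v (x v).2 * (y v).1.
  under eq_bigr do rewrite yG mulr_sumr.
  under [RHS]eq_bigr do rewrite xG mulr_suml.
  rewrite exchange_big /=; apply: eq_bigr => v _; apply: eq_bigr => w _.
  by rewrite !ffunE adj_sym mulrCA mulrA.
exact: (@F2_addvv F^o).
Qed.

Lemma graph_lagrangian G : lagrangian (graph_space G).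
Proof.
split; first exact: graph_isotropic.
rewrite limg_dim_eq; first by rewrite dimvf /dim /= muln1.
apply/eqP; rewrite -subv0; apply/subvP => x /memv_capP[_].
rewrite memv_ker lfunE memv0 => /eqP/ffunP x0; apply/eqP/ffunP => v.
by have := congr1 fst (x0 v); rewrite !ffunE.
Qed.

(** The cut matrix over an arbitrary two-element field; at ['F_2] it is [cut_matrix]. *)
Definition cut_mx G X : 'M[F]_(#|X|, #|vertices G :\: X|) :=
  \matrix_(i, j) (adj G (enum_val i) (enum_val j))%:R.

Lemma dim_row_image n r (h : {linear 'rV[F]_n -> vT}) (B : 'M[F]_(r, n)) :
  injective h -> row_free B -> \dim (\sum_(i < r) <[h (row i B)]>) = r.
Proof.
move=> h_inj freeB.
have row0 (c : 'rV_r) : h (c *m B) = 0 -> c = 0.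
  rewrite -[0](linear0 h) => /h_inj cB; apply: (row_free_inj freeB).
  by rewrite cB mul0mx.
have hsum (c : 'rV_r) : h (c *m B) = \sum_i c 0 i *: h (row i B).
  by rewrite mulmx_sum_row linear_sum; apply: eq_bigr => i _; rewrite linearZ.
have /directvP : directv (\sum_(i < r) <[h (row i B)]>)%VS.
  apply/directv_sum_independent => us usB sum0 i _.
  have [c cE] : exists c : 'I_r -> F, forall i, us i = c i *: h (row i B).
    by apply: (@fin_all_exists _ (fun=> F) (fun i c => us i = c *: h (row i B))) => j;
       apply/vlineP/usB.
  have := row0 (\row_i c i); rewrite hsum.
  under eq_bigr do rewrite mxE -cE.
  by move=> /(_ sum0)/rowP/(_ i); rewrite !mxE cE => ->; rewrite scale0r.
move=> /= ->; rewrite -[RHS]card_ord -sum1_card; apply: eq_bigr => i _.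
rewrite dim_vline; have [hi|//] := eqVneq (h (row i B)) 0.
have := row0 (delta_mx 0 i); rewrite -rowE => /(_ hi)/rowP/(_ i).
by rewrite !mxE !eqxx => /eqP; rewrite oner_eq0.
Qed.

(** A vector (x, A x) is supported on X exactly when x is, and its part on X is in the left kernel
    of the cut matrix. *)
Lemma graph_loc_dim G X : X \subset vertices G ->
  (\dim (loc (graph_space G) X) + \rank (cut_mx G X))%N = #|X|.
Proof.
move=> XV.
pose ext (r : 'rV[F]_#|X|) : {ffun U -> F^o} :=
  [ffun w => (\sum_i (enum_val i == w)%:R * r 0 i : F)].
have ext_lin : linear ext.
  move=> a r s; apply/ffunP => w; rewrite !ffunE.
    apply: etrans (_ : _ = a * _ + _) _ => //; rewrite mulr_sumr -big_split.
    by apply: eq_bigr => i _ /=; rewrite !mxE mulrDr mulrCA.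
pose extL : {linear 'rV[F]_#|X| -> {ffun U -> F^o}} :=
  HB.pack ext (GRing.isLinear.Build F _ _ _ ext ext_lin).
have extE r i : ext r (enum_val i) = r 0 i.
  rewrite ffunE (bigD1 i) //= eqxx mul1r big1 ?addr0 // => j /negPf ji.
  by rewrite (inj_eq enum_val_inj) ji mul0r.
have ext0 r v : v \notin X -> ext r v = 0.
  move=> vX; rewrite ffunE big1 // => j _; case: eqP => [jv|_]; last by rewrite mul0r.
  by rewrite -jv enum_valP in vX.
have nbrE r v : nbr_sum G (ext r) v = \sum_i (adj G v (enum_val i))%:R * r 0 i.
  rewrite /nbr_sum (bigID (mem X)) /= [X in _ + X]big1 ?addr0.
    by rewrite big_enum_val; apply: eq_bigr => i _; rewrite extE.
  by move=> w wX; rewrite ext0 ?mulr0.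
pose h : {linear 'rV[F]_#|X| -> vT} := graph_vec G \o extL.
have hE r v : h r v = (ext r v, nbr_sum G (ext r) v) by apply: graph_vecE.
have hfst r v : (h r v).1 = ext r v by rewrite hE.
have h_inj : injective h.
  by move=> r s rs; apply/rowP => i; rewrite -!extE -!hfst rs.
pose M := cut_mx G X.
have ME i j : M i j = (adj G (enum_val i) (enum_val j))%:R by rewrite mxE.
pose B := row_base (kermx M).
have locE : loc (graph_space G) X = (\sum_i <[h (row i B)]>)%VS.
  apply/eqP; rewrite eqEsubv; apply/andP; split; last first.
    apply/subv_sumP => i _; rewrite -memvE; apply/locP; split.
      by apply/memv_imgP; exists (ext (row i B)); rewrite ?memvf ?lfunE.
    move=> v vX; rewrite hE ext0 // nbrE.
    have [vV|vV] := boolP (v \in vertices G); last first.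
      rewrite big1 // => j _; case: (boolP (adj _ _ _)) => [/adj_vertex av|_].
        by rewrite av in vV.
      by rewrite mul0r.
    have vVX : v \in vertices G :\: X by rewrite inE vX.
    have : row i B *m M = 0.
      by apply/sub_kermxP; apply: submx_trans (row_sub _ _) _; rewrite eq_row_base.
    move=> /rowP/(_ (enum_rank_in vVX v)); rewrite !mxE => BM; congr (_, _).
    rewrite -[RHS]BM; apply: eq_bigr => j _.
    by rewrite ME enum_rankK_in // mulrC adj_sym.
  apply/subvP => x /locP[/graph_spaceP xG x0].
  pose r : 'rV[F]_#|X| := \row_i (x (enum_val i)).1.
  have extr : ext r = fst_vec x.
    apply/ffunP => v; have [vX|vX] := boolP (v \in X).
      by rewrite -(enum_rankK_in vX vX) extE !mxE ffunE.
    by rewrite ext0 // ffunE x0.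
  have xE : x = h r.
    by apply/ffunP => v; rewrite hE extr -xG ffunE; case: (x v).
  have : (r <= kermx M)%MS.
    apply/sub_kermxP/rowP => j; rewrite !mxE.
    have := xG (enum_val j); rewrite x0; last by have /setDP[] := enum_valP j.
    rewrite -extr nbrE => xj; rewrite [RHS]xj; apply: eq_bigr => i _.
    by rewrite ME mulrC adj_sym.
  rewrite -(eq_row_base (kermx M)) => /submxP[c rE].
  rewrite xE rE mulmx_sum_row linear_sum; apply: memv_sumr => i _.
  by rewrite linearZ memvZ // memv_line.
rewrite locE dim_row_image ?row_base_free // mxrank_ker subnK //.
exact: rank_leq_row.
Qed.

(** * Vertex deletion, local complementation and pivoting as operations on spaces *)

Lemma loc_delete G v X : v \notin X ->
  loc (graph_space (delete G v)) X = loc (red (graph_space G) v (0, 1)) X.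
Proof.
move=> vX; have sumE (x y : vT) u : u != v -> (y v).1 = 0 ->
    (forall w, w != v -> (x w).1 = (y w).1) ->
    nbr_sum (delete G v) (fst_vec x) u = nbr_sum G (fst_vec y) u.
  move=> uv yv xy; apply: eq_bigr => w _; rewrite /= /delete_adj uv !ffunE /=.
  by case: eqVneq => [->|wv]; rewrite ?yv ?mulr0 ?mul0r // xy.
have delv (x : vT) : nbr_sum (delete G v) (fst_vec x) v = 0.
  by apply: big1 => w _; rewrite /= /delete_adj eqxx mul0r.
apply/vspaceP => x; apply/locP/locP => -[xG x0]; split=> //; last first.
  have [y /graph_spaceP yG [yv xE]] := redP _ _ _ _ xG.
  have yv0 : (y v).1 = 0 by move: yv; rewrite /omega /= mulr1 mulr0 addr0.
  have xy w : w != v -> x w = y w.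
    by move=> /negPf wv; case: xE => ->; rewrite // ffunE singleE wv addr0.
  apply/graph_spaceP => u; have [->|uv] := eqVneq u v; first by rewrite x0 // delv.
  by rewrite (sumE x y) // => [|w /xy->//]; rewrite -yG xy.
have xv := x0 v vX; move/graph_spaceP in xG.
(* Deletion erases the entry of A x at [v]; [q] is that entry in [G], and [y] restores it. *)
pose q := nbr_sum G (fst_vec x) v; pose y := x + single v (0, q : F^o).
have yE w : w != v -> y w = x w by move=> /negPf wv; rewrite ffunE singleE wv addr0.
have yv : y v = (0, q : F^o) by rewrite ffunE singleE eqxx xv add0r.
have fyx : fst_vec y = fst_vec x.
  apply/ffunP => w; rewrite !ffunE; have [->|wv] := eqVneq w v; last exact: addr0.
  by rewrite xv add0r.
have yG : y \in graph_space G.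
  apply/graph_spaceP => u; have [->|uv] := eqVneq u v; first by rewrite fyx yv.
  rewrite yE // xG; apply: sumE => // [|w /yE-> //]; by rewrite yv.
apply/redP; exists y => //; split; first by rewrite yv /omega /= mul0r mulr0 addr0.
have [q0|q1] := F2_cases q; [left | right].
  rewrite /y q0; suff -> : single v (0, 0 : F^o) = 0 by rewrite addr0.
  by apply/ffunP => w; rewrite singleE ffunE if_same.
by rewrite /y q1 -addrA F2_addvv addr0.
Qed.

(* The effect of local complementation at [v] on members of [graph_space G]; unlike
   the graph operation itself, it acts separately at each vertex. *)
Definition lc_map G v (x : vT) : vT := [ffun w =>
  if w == v then ((x w).1 + (x w).2, (x w).2)
  else if adj G v w then ((x w).1, (x w).1 + (x w).2) else x w].

Lemma lc_map_linear G v : linear (lc_map G v).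
Proof.
move=> a x y; apply/ffunP => w; rewrite !ffunE.
case: ifP => _; [|case: ifP => _ //]; congr (_, _) => //=.
  by rewrite addrACA scalerDr.
by rewrite addrACA scalerDr.
Qed.
HB.instance Definition _ G v :=
  GRing.isLinear.Build F vT vT _ (lc_map G v) (lc_map_linear G v).

Lemma lc_map_eq0 G v x w : (lc_map G v x w == 0) = (x w == 0).
Proof.
rewrite ffunE; have [->|->|->|->] := K_cases (x w); case: ifP => _; try case: ifP => _;
  by rewrite /= ?xpair_eqE ?F2_11 ?addr0 ?add0r ?eqxx ?oner_eq0.
Qed.

Lemma addb_natr (b c : bool) : (b (+) c)%:R = b%:R + c%:R :> F.
Proof. by case: b; case: c; rewrite ?addr0 ?add0r // F2_11. Qed.

(** With a the row of [v] in A, local complementation adds to A the matrix of products a_w a_t with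
    its diagonal cleared. The clearing produces the term (x w).1 at neighbors of [v]; the change of
    first entry at [v] cancels the remaining terms. *)
Lemma lc_map_space G v x : x \in graph_space G ->
  lc_map G v x \in graph_space (local_compl G v).
Proof.
move=> /graph_spaceP xG; set y := lc_map G v x.
have y1 t : (y t).1 = (x t).1 + (t == v)%:R * (x v).2.
  rewrite /y ffunE; case: eqVneq => [->|_]; first by rewrite mul1r.
  by rewrite mul0r addr0; case: ifP.
have sumx w : \sum_t (adj G w t)%:R * ((x t).1 : F) = (x w).2.
  by rewrite xG; apply: eq_bigr => t _; rewrite ffunE.
have deltav (h : U -> F) : \sum_t h t * ((t == v)%:R * ((x v).2 : F)) = h v * (x v).2.
  rewrite (bigD1 v) //= eqxx mul1r big1 ?addr0 // => t /negPf ->.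
  by rewrite mul0r mulr0.
apply/graph_spaceP => w.
have -> : nbr_sum (local_compl G v) (fst_vec y) w =
    \sum_t ((adj G w t)%:R + (adj G v w)%:R * (adj G v t)%:R * (w != t)%:R)
           * ((y t).1 : F).
  apply: eq_bigr => t _; rewrite ffunE /= /local_compl_adj addb_natr.
  by congr ((_ + _) * _); rewrite -!mulnb !natrM [RHS]mulrC mulrA.
under eq_bigr do rewrite mulrDl y1 mulrDr.
rewrite !big_split /= sumx (deltav (fun t => (adj G w t)%:R)).
have -> : \sum_t (adj G v w)%:R * (adj G v t)%:R * (w != t)%:R *
     (((x t).1 : F) + (t == v)%:R * ((x v).2 : F)) =
   (adj G v w)%:R * ((x v).2 + (x w).1).
  case: (boolP (adj G v w)) => avw; last by rewrite mul0r big1 // => t _; rewrite !mul0r.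
  rewrite mul1r -[in RHS]sumx (bigD1 w) //= eqxx mulr0 mul0r add0r.
  rewrite [in RHS](bigD1 w) //= avw mul1r addrAC F2_addvv add0r.
  apply: eq_bigr => t tw; rewrite eq_sym tw mul1r mulr1.
  by case: eqVneq => [->|_]; rewrite ?adj_irrefl ?mul0r // addr0.
rewrite /y ffunE /=; case: eqVneq => [->|_].
  by rewrite adj_irrefl /= !mul0r !addr0.
case: ifP => avw; last by rewrite adj_sym avw !mul0r !addr0.
by rewrite adj_sym avw !mul1r addrA -[_ + _ + (x v).2]addrA F2_addvv addr0 addrC.
Qed.

Lemma lc_map_limg G v :
  (linfun (lc_map G v) @: graph_space G)%VS = graph_space (local_compl G v).
Proof.
apply/eqP; rewrite eqEdim; apply/andP; split.
  by apply/subvP => _ /memv_imgP[x xG ->]; rewrite lfunE lc_map_space.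
rewrite limg_dim_eq; first by rewrite !(graph_lagrangian _).2.
apply/eqP; rewrite -subv0; apply/subvP => x /memv_capP[_].
rewrite memv_ker lfunE memv0 => /eqP/ffunP x0; apply/eqP/ffunP => w.
by have := x0 w; rewrite ![(0 : vT) w]ffunE => /eqP; rewrite lc_map_eq0 => /eqP.
Qed.

Definition pivot_map G u v : 'End(vT) :=
  (linfun (lc_map (local_compl (local_compl G u) v) u) \o
   linfun (lc_map (local_compl G u) v) \o linfun (lc_map G u))%VF.

Lemma pivot_mapE G u v x : pivot_map G u v x =
  lc_map (local_compl (local_compl G u) v) u (lc_map (local_compl G u) v (lc_map G u x)).
Proof. by rewrite !comp_lfunE !lfunE. Qed.

Lemma pivot_map_eq0 G u v x w : (pivot_map G u v x w == 0) = (x w == 0).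
Proof. by rewrite pivot_mapE !lc_map_eq0. Qed.

Lemma pivot_map_limg G u v :
  (pivot_map G u v @: graph_space G)%VS = graph_space (pivot G u v).
Proof. by rewrite !limg_comp !lc_map_limg. Qed.

(** The edge uv survives the first two local complementations, so at [v] the three maps send (a, b)
    to (a, a+b), (b, a+b) and (b, a). *)
Lemma pivot_map_swap G u v x : adj G v u ->
  pivot_map G u v x v = ((x v).2, (x v).1).
Proof.
move=> avu; have vu : (v == u) = false.
  by apply: contraTF avu => /eqP->; rewrite adj_irrefl.
have auv : adj G u v by rewrite adj_sym.
have auv1 : adj (local_compl G u) u v.
  by rewrite /= /local_compl_adj auv adj_irrefl !andbF.
have auv2 : adj (local_compl (local_compl G u) v) u v.
  by rewrite /= /local_compl_adj auv1 adj_irrefl !andbF.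
rewrite pivot_mapE ffunE vu auv2 ffunE eqxx ffunE vu auv /=.
by rewrite addrA F2_addvv add0r addrCA F2_addvv addr0.
Qed.

(** The pivot map is injective, preserves supports and exchanges (1,0) and (0,1) at [v], so it
    carries one reduction onto the other. *)
Lemma loc_pivot_dim G u v X : adj G v u ->
  \dim (loc (red (graph_space (pivot G u v)) v (0, 1)) X) =
  \dim (loc (red (graph_space G) v (1, 0)) X).
Proof.
move=> avu; pose p := pivot_map G u v.
have p0 : (lker p = 0)%VS.
  apply/eqP; rewrite -subv0; apply/subvP => x; rewrite memv_ker memv0.
  move=> /eqP/ffunP px; apply/eqP/ffunP => w; apply/eqP.
  by have /eqP := px w; rewrite [in X in _ -> X]ffunE ffunE pivot_map_eq0.
have ps : p (single v (1, 0)) = single v (0, 1).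
  apply/ffunP => w; rewrite [RHS]singleE; have [->|wv] := eqVneq w v.
    by rewrite pivot_map_swap // singleE eqxx.
  by apply/eqP; rewrite pivot_map_eq0 singleE (negPf wv).
have po x : omega (p x v) (0, 1) = omega (x v) (1, 0).
  by rewrite pivot_map_swap // /omega /= !mulr0 !mulr1 addr0 add0r.
rewrite -[in RHS](@limg_dim_eq _ _ _ p) ?p0 ?capv0 //; congr (\dim _).
apply/vspaceP => z.
apply/locP/memv_imgP => [[/redP[y + [yo zE]] z0] | [x /locP[xR x0] ->]].
  rewrite -pivot_map_limg => /memv_imgP[x xG yx].
  have [x' x'R zx'] : exists2 x', x' \in red (graph_space G) v (1, 0) & z = p x'.
    have xo : omega (x v) (1, 0) = 0 by rewrite -po -yx.
    case: zE => ->; [exists x | exists (x + single v (1, 0))].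
    - by apply/redP; exists x => //; split=> //; left.
    - by [].
    - by apply/redP; exists x => //; split=> //; right.
    - by rewrite linearD /= ps yx.
  exists x' => //; apply/locP; split=> // w wX; apply/eqP.
  by rewrite -(pivot_map_eq0 G u v) -/p -zx' z0.
split=> [|w wX]; last by apply/eqP; rewrite pivot_map_eq0 x0.
have [y yG [yo xE]] := redP _ _ _ _ xR; apply/redP; exists (p y).
  by rewrite -pivot_map_limg memv_img.
by rewrite po; split=> //; case: xE => ->; rewrite ?linearD /= ?ps; [left|right].
Qed.
End Lagrangian.
End BinaryField.

(** * From Lagrangian spaces back to connectivity in graphs *)

Section GraphConnectivity.
Local Open Scope ring_scope.
Variable U : finType.
Implicit Types (G : graph U) (Q R X : {set U}).

Lemma card_F2 : #|'F_2| = 2%N.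
Proof. exact: card_Fp. Qed.

Lemma connectivityP G Q R k : Q \subset vertices G -> Q :&: R = set0 ->
  connectivity G Q R = k <->
  (forall X, sep Q (vertices G :\: R) X -> (k <= cut_rank G X)%N) /\
  exists2 X, sep Q (vertices G :\: R) X & (cut_rank G X <= k)%N.
Proof.
move=> QV QR; have sepQ : (Q \subset Q) && (Q \subset vertices G :\: R).
  by rewrite subxx subsetD QV -setI_eq0 QR eqxx.
rewrite /connectivity; case: arg_minnP => // Y sY minY.
split=> [<- | [ge [X sX leX]]]; first by split=> [X /minY //|]; exists Y.
by apply/eqP; rewrite eqn_leq ge // andbT (leq_trans (minY X sX)).
Qed.

Lemma cut_rankE G X : X \subset vertices G ->
  (\dim (loc (graph_space 'F_2 G) X) + cut_rank G X)%N = #|X|.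
Proof. exact: graph_loc_dim. Qed.

Lemma connectivity_conn_ge G Q R k : Q \subset vertices G -> Q :&: R = set0 ->
    connectivity G Q R = k ->
  conn_ge Q (vertices G :\: R) k (graph_space 'F_2 G) /\
  exists X, min_sep Q (vertices G :\: R) k (graph_space 'F_2 G) X.
Proof.
move=> QV QR /connectivityP[] // ge [Y sY leY].
have XV X : sep Q (vertices G :\: R) X -> X \subset vertices G.
  by case/andP=> _ /subset_trans; apply; apply: subsetDl.
split=> [X sX|]; first by rewrite -(cut_rankE (XV X sX)) leq_add2l ge.
by exists Y; split=> //; rewrite -(cut_rankE (XV Y sY)) leq_add2l.
Qed.

(* [H] stands for either of the two minors at [v]; [g] is the local type of the
   corresponding reduction. *)
Lemma minor_connectivity G (H : graph U) Q R k v (g : 'F_2 * 'F_2) :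
    Q \subset vertices G -> Q :&: R = set0 -> v \in vertices G :\: (Q :|: R) ->
    g != 0 -> vertices H = vertices G :\ v ->
    (forall X, X \subset vertices H ->
       \dim (loc (graph_space 'F_2 H) X) = \dim (loc (red (graph_space 'F_2 G) v g) X)) ->
    connectivity G Q R = k -> connectivity H Q R != k ->
  bad Q (vertices G :\: R) k (graph_space 'F_2 G) v g /\
  single v g \notin graph_space 'F_2 G.
Proof.
move=> QV QR; rewrite !inE negb_or => /andP[/andP[vQ vR] vV] g0 HV Hdim hk hH.
have [ge [Y mY]] := connectivity_conn_ge QV QR hk.
have isoG := @graph_isotropic _ card_F2 _ G.
have vD : v \in vertices G :\: R by rewrite inE vR.
(* If the reduction kept the lower bound, then [H] would have connectivity exactly [k], a minimum
   cut of [G] without [v] giving the upper bound. *)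
apply: (red_not_conn_ge card_F2 vD vQ isoG g0 ge) => geR.
have sepH X : sep Q (vertices H :\: R) X ->
    sep Q (vertices G :\: R) X /\ X \subset vertices H.
  case/andP=> QX XH; split; last by apply: subset_trans XH (subsetDl _ _).
  by rewrite /sep QX (subset_trans XH) // HV setSD // subsetDl.
have QH : Q \subset vertices H by rewrite HV subsetD1 QV.
case/negP: hH; apply/eqP/connectivityP => //; split=> [X /sepH[sX XH]|].
  by have := geR X sX; rewrite -Hdim // -(cut_rankE XH) leq_add2l.
have sY : sep Q (vertices H :\: R) (Y :\ v).
  have /andP[QY YD] := sepD1 mY.1 vQ; rewrite /sep QY HV.
  by rewrite setDDl setUC -setDDl subsetD1 YD !inE eqxx.
exists (Y :\ v) => //; have := red_min_sep card_F2 v isoG g0 mY.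
have [_ YH] := sepH _ sY.
by rewrite -Hdim // -(cut_rankE YH) leq_add2l.
Qed.

Lemma delete_connectivity G Q R k v :
    Q \subset vertices G -> Q :&: R = set0 -> v \in vertices G :\: (Q :|: R) ->
    connectivity G Q R = k -> connectivity (delete G v) Q R != k ->
  bad Q (vertices G :\: R) k (graph_space 'F_2 G) v (0, 1) /\
  single v (0, 1) \notin graph_space 'F_2 G.
Proof.
move=> QV QR vD; apply: minor_connectivity => //= X.
by rewrite subsetD1 => /andP[_ vX]; rewrite loc_delete ?card_F2.
Qed.

Lemma pivot_connectivity G Q R k u v : adj G v u ->
    Q \subset vertices G -> Q :&: R = set0 -> v \in vertices G :\: (Q :|: R) ->
    connectivity G Q R = k -> connectivity (delete (pivot G u v) v) Q R != k ->
  bad Q (vertices G :\: R) k (graph_space 'F_2 G) v (1, 0) /\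
  single v (1, 0) \notin graph_space 'F_2 G.
Proof.
move=> avu QV QR vD; apply: minor_connectivity => //= X.
by rewrite subsetD1 => /andP[_ vX]; rewrite loc_delete ?card_F2 // loc_pivot_dim ?card_F2.
Qed.

End GraphConnectivity.

Theorem corollary1p3 (U : finType) (G : graph U) (Q R S T : {set U})
  (k l : nat)
  (hQ : Q \subset vertices G) (hR : R \subset vertices G)
  (hS : S \subset vertices G) (hT : T \subset vertices G)
  (hQR : Q :&: R = set0) (hST : S :&: T = set0)
  (hk : connectivity G Q R = k) (hl : connectivity G S T = l) :
  let F := vertices G :\: (Q :|: R :|: S :|: T) in
  (2 * l + 1) * 2 ^ (2 * k) <= #|F| ->
  exists v : U, v \in F /\
    ((connectivity (delete G v) Q R = k /\
      connectivity (delete G v) S T = l) \/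
     (forall u : U, adj G v u ->
        connectivity (delete (pivot G u v) v) Q R = k /\
        connectivity (delete (pivot G u v) v) S T = l)).
Proof.
move=> F le_F.
pose D := vertices G :\: R; pose E := vertices G :\: T.
pose okD v := (connectivity (delete G v) Q R == k) &&
              (connectivity (delete G v) S T == l).
pose okP v u := (connectivity (delete (pivot G u v) v) Q R == k) &&
                (connectivity (delete (pivot G u v) v) S T == l).
have [/exists_inP[v vF ok] | none] :=
  boolP [exists v in F, okD v || [forall u, adj G v u ==> okP v u]].
  exists v; split=> //; case/orP: ok => [/andP[/eqP ? /eqP ?]|/forallP ok]; first by left.
  by right=> u avu; have /implyP/(_ avu)/andP[/eqP ? /eqP ?] := ok u.
have fail v : v \in F -> ~~ okD v /\ exists2 u, adj G v u & ~~ okP v u.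
  move=> vF; move/exists_inPn/(_ v vF): none; rewrite negb_or => /andP[-> /forallPn[u]].
  by rewrite negb_imply => /andP[avu nok]; split=> //; exists u.
have FE : F = (D :\: Q) :&: (E :\: S).
  apply/setP => v; rewrite !inE; case: (v \in Q); case: (v \in R); case: (v \in S);
    by case: (v \in T); rewrite /= ?andbT ?andbF ?andbb.
have vQR v : v \in F -> v \in vertices G :\: (Q :|: R).
  by rewrite !inE !negb_or => /andP[/andP[/andP[/andP[-> ->] _] _] ->].
have vST v : v \in F -> v \in vertices G :\: (S :|: T).
  by rewrite !inE !negb_or => /andP[/andP[/andP[_ ->] ->] ->].
have QD : Q \subset D by rewrite subsetD hQ -setI_eq0 hQR eqxx.
have SE : S \subset E by rewrite subsetD hS -setI_eq0 hST eqxx.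
have [geQ _] := connectivity_conn_ge hQ hQR hk.
have [geS mS] := connectivity_conn_ge hS hST hl.
have n10 : (1, 0)%R != 0%R :> 'F_2 * 'F_2 by rewrite xpair_eqE oner_eq0.
have n01 : (0, 1)%R != 0%R :> 'F_2 * 'F_2 by rewrite xpair_eqE oner_eq0 andbF.
have n11 : (1, 1)%R != 0%R :> 'F_2 * 'F_2 by rewrite xpair_eqE oner_eq0.
pose delQ v := connectivity (delete G v) Q R != k.
(* [e v] is to be the bad value for (Q,R) and [e' v] the one for (S,T); both differ from the value
   (1,1) imposed on F. *)
pose e v : 'F_2 * 'F_2 := if delQ v then (0, 1)%R else (1, 0)%R.
pose e' v : 'F_2 * 'F_2 := if delQ v then (1, 0)%R else (0, 1)%R.
have e_n0 v : e v != 0%R by rewrite /e; case: ifP.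
have e'_n0 v : e' v != 0%R by rewrite /e'; case: ifP.
have e_n11 v : e v != (1, 1)%R.
  by rewrite /e; case: ifP; rewrite xpair_eqE eq_sym oner_eq0 ?andbF.
have e'_n11 v : e' v != (1, 1)%R.
  by rewrite /e'; case: ifP; rewrite xpair_eqE eq_sym oner_eq0 ?andbF.
have e'_e v : e' v != e v.
  by rewrite /e /e'; case: ifP; rewrite xpair_eqE ?oner_eq0 // eq_sym oner_eq0.
(* Deletion and some pivot both fail at v. They cannot fail for the same pair of terminals, as (0,1)
   and (1,0) would both be bad for it; hence each pair is spoiled by exactly one of the two. *)
have key v : v \in F -> [/\ bad Q D k (graph_space 'F_2 G) v (e v),
    single v (e v) \notin graph_space 'F_2 G & bad S E l (graph_space 'F_2 G) v (e' v)].
  move=> vF; have [nD [u avu nP]] := fail v vF.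
  have [vD vE] : v \in D /\ v \in E.
    by move: vF; rewrite FE => /setIP[/setDP[-> _] /setDP[-> _]].
  rewrite /e /e'; case: ifPn => dQ.
    have [bQ sQ] := delete_connectivity hQ hQR (vQR v vF) hk dQ; split=> //.
    have [pQ | pQ] := eqVneq (connectivity (delete (pivot G u v) v) Q R) k.
      rewrite /okP pQ eqxx /= in nP.
      by have [] := pivot_connectivity avu hS hST (vST v vF) hl nP.
    have [bQ' _] := pivot_connectivity avu hQ hQR (vQR v vF) hk pQ.
    by case: (bad_unique card_F2 vD geQ n01 n10 bQ bQ') => /eqP; rewrite eq_sym oner_eq0.
  rewrite negbK in dQ; rewrite /okD dQ /= in nD.
  have [bS _] := delete_connectivity hS hST (vST v vF) hl nD.
  have [pS | pS] := eqVneq (connectivity (delete (pivot G u v) v) S T) l.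
    rewrite /okP pS eqxx andbT in nP.
    by have [] := pivot_connectivity avu hQ hQR (vQR v vF) hk nP.
  have [bS' _] := pivot_connectivity avu hS hST (vST v vF) hl pS.
  by case: (bad_unique card_F2 vE geS n01 n10 bS bS') => /eqP; rewrite eq_sym oner_eq0.
suff : (#|F| < (2 * l + 1) * 2 ^ (2 * k))%N by rewrite ltnNge le_F.
rewrite FE in key *.
apply: (@conflict_bound _ card_F2 U Q D S E k l (graph_space 'F_2 G) (1, 1)%R e e') => //.
- exact: (@graph_lagrangian _ card_F2 _ G).
- by move=> v /key[].
- by move=> v /key[].
Qed.
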